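(* GYZ-authentication implies DNS-authentication: there exist absolute constants $\varepsilon_0>0$ and $c>0$ such that for every $0<\varepsilon\le\varepsilon_0$, every symmetric-key quantum encryption scheme $(\tau_K,E,D)$ that is $\varepsilon$-GYZ-authenticating is $c\sqrt\varepsilon$-DNS-authenticating.
   Context: All Hilbert spaces are finite-dimensional; a tensor factor on which a map is not specified to act carries the identity. A symmetric-key quantum encryption scheme (QES) is a triple $(\tau_K,E,D)$ of the uniform classical key state $\tau_K=\frac1{|K|}\sum_k|k\rangle\langle k|$ and channels $E:\mathrm{End}(\mathcal H_A\otimes\mathcal H_K)\to\mathrm{End}(\mathcal H_C\otimes\mathcal H_K)$, $D:\mathrm{End}(\mathcal H_C\otimes\mathcal H_K)\to\mathrm{End}((\mathcal H_A\oplus\mathbb C|\bot\rangle)\otimes\mathcal H_K)$ (key register unchanged) with $(D\circ E)(X\otimes|k\rangle\langle k|)=(X\oplus0_\bot)\otimes|k\rangle\langle k|$ for all $k$. $|\bot\rangle$ is the reject symbol; one may assume that $D$ includes the measurement of $|\bot\rangle$ versus $\mathcal H_A$, i.e. its output is block diagonal with respect to $\mathcal H_A\oplus\mathbb C|\bot\rangle$. $\varepsilon$-DNS-authenticating: for any CPTP map $\Lambda_{CB\to C\tilde B}$ there exist CP maps $\Lambda^{\mathrm{acc}}_{B\to\tilde B}$, $\Lambda^{\mathrm{rej}}_{B\to\tilde B}$ with $\Lambda^{\mathrm{acc}}+\Lambda^{\mathrm{rej}}$ trace preserving such that for all states $\rho_{AB}$, $$\big\|\mathrm{tr}_KD(\Lambda(E(\rho_{AB}\otimes\tau_K)))-\big(\Lambda^{\mathrm{acc}}(\rho_{AB})+|\bot\rangle\langle\bot|\otimes\Lambda^{\mathrm{rej}}(\rho_B)\big)\big\|_1\le\varepsilon.$$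 $\varepsilon$-GYZ-authenticating (also called $\varepsilon$-totally authenticating): for any CPTP map $\Lambda_{CB\to C\tilde B}$ there exists a CP map $\Lambda^{\mathrm{acc}}_{B\to\tilde B}$ such that for all states $\rho_{AB}$, $$\big\|\Pi_{\mathrm{acc}}D(\Lambda(E(\rho_{AB}\otimes\tau_K)))\Pi_{\mathrm{acc}}-\Lambda^{\mathrm{acc}}(\rho_{AB})\otimes\tau_K\big\|_1\le\varepsilon,$$ where $\Pi_{\mathrm{acc}}$ is the projector onto $\mathcal H_A$ in $\mathcal H_A\oplus\mathbb C|\bot\rangle$. Here systems $B,\tilde B$ are arbitrary, and $\Lambda^{\mathrm{acc}}(\rho_{AB})$ means $(\mathrm{id}_A\otimes\Lambda^{\mathrm{acc}})(\rho_{AB})$. *)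

(* Defs.v *)
From HB Require Import structures.
From mathcomp Require Import all_boot all_order all_algebra.
From mathcomp Require Import reals.
From mathcomp Require Export complex mxtens.

Set Implicit Arguments.
Unset Strict Implicit.
Unset Printing Implicit Defensive.

Import Order.TTheory GRing.Theory Num.Theory.
Local Open Scope ring_scope.
Local Open Scope complex_scope.
Local Open Scope sesquilinear_scope.

(* The Hilbert space C^n is represented by its dimension n, operators on it by
   'M[R[i]]_n, and C^m (x) C^n by the dimension m * n, with the index pairing
   mxtens_index and the Kronecker product A *t B of real_closed.mxtens. *)

Definition psd (R : realType) (n : nat) (X : 'M[R[i]]_n) : Prop :=
  forall v : 'cV[R[i]]_n, 0 <= (v^t* *m X *m v) 0 0.

Definition state (R : realType) (n : nat) (X : 'M[R[i]]_n) : Prop :=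
  psd X /\ \tr X = 1.

(* |X| = sqrt (X^* X), by functional calculus; X^* X is Hermitian, hence
   spectralmx unitarily diagonalizes it. *)
Definition absmx (R : realType) (n : nat) (X : 'M[R[i]]_n) : 'M[R[i]]_n :=
  let H := X^t* *m X in
  invmx (spectralmx H) *m diag_mx (map_mx sqrtC (spectral_diag H))
    *m spectralmx H.

(* \tr |X| is real, so that no information is lost in taking its real part. *)
Definition trnorm (R : realType) (n : nat) (X : 'M[R[i]]_n) : R :=
  complex.Re (\tr (absmx X)).

(* The tensor product f (x) g of two linear maps on operators, by bilinear
   expansion on matrix units; see tensmapE. *)
Definition tensmap (R : realType) (m m' n n' : nat)
    (f : 'M[R[i]]_m -> 'M[R[i]]_m') (g : 'M[R[i]]_n -> 'M[R[i]]_n')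
    (X : 'M[R[i]]_(m * n)%N) : 'M[R[i]]_(m' * n')%N :=
  \sum_(i < m) \sum_(j < m) \sum_(k < n) \sum_(l < n)
    X (mxtens_index (i, k)) (mxtens_index (j, l)) *:
      (f (delta_mx i j) *t g (delta_mx k l)).

Lemma tensmapE (R : realType) (m m' n n' : nat)
    (f : {linear 'M[R[i]]_m -> 'M[R[i]]_m'})
    (g : {linear 'M[R[i]]_n -> 'M[R[i]]_n'})
    (A : 'M[R[i]]_m) (B : 'M[R[i]]_n) :
  tensmap f g (A *t B) = f A *t g B.
Proof.
rewrite {2}[A]matrix_sum_delta {2}[B]matrix_sum_delta !linear_sum /=.
have sumE I (r : seq I) (F : I -> 'M[R[i]]_m') (C : 'M[R[i]]_n') :
    (\sum_(i <- r) F i) *t C = \sum_(i <- r) F i *t C.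
  by apply: (big_morph (fun X => X *t C)) => [X Y|];
    rewrite ?tens0mx //; apply/matrixP=> x y; rewrite !mxE mulrDl.
have sumEr I (r : seq I) (F : I -> 'M[R[i]]_n') (C : 'M[R[i]]_m') :
    C *t (\sum_(i <- r) F i) = \sum_(i <- r) C *t F i.
  by apply: (big_morph (fun X => C *t X)) => [X Y|];
    rewrite ?tensmx0 //; apply/matrixP=> x y; rewrite !mxE mulrDr.
rewrite sumE; apply: eq_bigr => i _; rewrite linear_sum sumE.
apply: eq_bigr => j _; rewrite sumEr; apply: eq_bigr => k _.
rewrite linear_sum sumEr; apply: eq_bigr => l _.
by rewrite !linearZ tensmxE; apply/matrixP=> x y; rewrite !mxE mulrACA.
Qed.

Definition cp_map (R : realType) (m n : nat)
    (f : {linear 'M[R[i]]_m -> 'M[R[i]]_n}) : Prop :=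
  forall (r : nat) (X : 'M[R[i]]_(r * m)%N),
    psd X -> psd (tensmap (@idfun 'M[R[i]]_r) f X).

Definition channel (R : realType) (m n : nat)
    (f : {linear 'M[R[i]]_m -> 'M[R[i]]_n}) : Prop :=
  cp_map f /\ forall X : 'M[R[i]]_m, \tr (f X) = \tr X.

Definition ptrace1 (R : realType) (m n : nat) (X : 'M[R[i]]_(m * n)%N) :
    'M[R[i]]_n :=
  \matrix_(i, j) \sum_(k < m) X (mxtens_index (k, i)) (mxtens_index (k, j)).

Definition ptrace2 (R : realType) (m n : nat) (X : 'M[R[i]]_(m * n)%N) :
    'M[R[i]]_m :=
  \matrix_(i, j) \sum_(k < n) X (mxtens_index (i, k)) (mxtens_index (j, k)).

(* Reordering of tensor factors X (x) Y (x) Z -> X (x) Z (x) Y. *)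
Definition swap_index (m n p : nat) (i : 'I_(m * n * p)%N) :
    'I_(m * p * n)%N :=
  let: (xy, z) := mxtens_unindex i in
  let: (x, y) := mxtens_unindex xy in
  mxtens_index (mxtens_index (x, z), y).

Definition swapmx (R : realType) (m n p : nat)
    (X : 'M[R[i]]_(m * n * p)%N) : 'M[R[i]]_(m * p * n)%N :=
  mxsub (@swap_index m p n) (@swap_index m p n) X.

Lemma swapmxE (R : realType) (m n p : nat)
    (A : 'M[R[i]]_m) (B : 'M[R[i]]_n) (C : 'M[R[i]]_p) :
  swapmx (A *t B *t C) = A *t C *t B.
Proof.
apply/matrixP=> i j; case: (mxtens_indexP i) => i' y.
case: (mxtens_indexP j) => j' y'; case: (mxtens_indexP i') => x z.
case: (mxtens_indexP j') => x' z'.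
by rewrite mxE /swap_index !mxtens_indexK !tensmxE mulrAC.
Qed.

(* H_A (+) C|bot> is C^(a + 1), with |bot> the last basis vector. *)
Definition accmx (R : realType) (a : nat) (X : 'M[R[i]]_a) :
    'M[R[i]]_(a + 1)%N := block_mx X 0 0 0.

Definition Pacc (R : realType) (a : nat) : 'M[R[i]]_(a + 1)%N :=
  block_mx 1%:M 0 0 0.

Definition Pbot (R : realType) (a : nat) : 'M[R[i]]_(a + 1)%N :=
  block_mx 0 0 0 1%:M.

Record qes (R : realType) := Qes {
  dimA : nat;
  dimK : nat;
  dimC : nat;
  dimA_gt0 : (0 < dimA)%N;
  dimK_gt0 : (0 < dimK)%N;
  dimC_gt0 : (0 < dimC)%N;
  enc : {linear 'M[R[i]]_(dimA * dimK)%N -> 'M[R[i]]_(dimC * dimK)%N};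
  dec : {linear 'M[R[i]]_(dimC * dimK)%N -> 'M[R[i]]_((dimA + 1) * dimK)%N};
  enc_channel : channel enc;
  dec_channel : channel dec;
  (* E and D leave the classical key register unchanged *)
  enc_key : forall (k : 'I_dimK) (X : 'M[R[i]]_dimA),
    exists Y : 'M[R[i]]_dimC, enc (X *t delta_mx k k) = Y *t delta_mx k k;
  dec_key : forall (k : 'I_dimK) (Y : 'M[R[i]]_dimC),
    exists Z : 'M[R[i]]_(dimA + 1)%N,
      dec (Y *t delta_mx k k) = Z *t delta_mx k k;
  (* D includes the measurement of |bot> versus H_A *)
  dec_block : forall Y : 'M[R[i]]_(dimC * dimK)%N,
    dec Y = (Pacc R dimA *t 1%:M) *m dec Y *m (Pacc R dimA *t 1%:M)
          + (Pbot R dimA *t 1%:M) *m dec Y *m (Pbot R dimA *t 1%:M);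
  dec_enc : forall (k : 'I_dimK) (X : 'M[R[i]]_dimA),
    dec (enc (X *t delta_mx k k)) = accmx X *t delta_mx k k
}.

Definition tauK (R : realType) (S : qes R) : 'M[R[i]]_(dimK S) :=
  (dimK S)%:R^-1 *: \sum_(k < dimK S) delta_mx k k.

(* D (Lambda (E (rho_AB (x) tau_K))) as an operator on
   (H_A (+) C|bot>) (x) B~ (x) K; the factors are kept in the order
   (message, side information, key) between the three maps. *)
Definition attacked (R : realType) (S : qes R) (b bt : nat)
    (L : 'M[R[i]]_(dimC S * b)%N -> 'M[R[i]]_(dimC S * bt)%N)
    (rho : 'M[R[i]]_(dimA S * b)%N) :
    'M[R[i]]_((dimA S + 1) * bt * dimK S)%N :=
  let encrypted : 'M_(dimC S * b * dimK S)%N :=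
    swapmx (tensmap (enc S) (@idfun 'M_b) (swapmx (rho *t tauK S))) in
  let tampered : 'M_(dimC S * bt * dimK S)%N :=
    tensmap L (@idfun 'M_(dimK S)) encrypted in
  swapmx (tensmap (dec S) (@idfun 'M_bt) (swapmx tampered)).

(* (id_A (x) L) (rho_AB), viewed as an operator on (H_A (+) C|bot>) (x) B~. *)
Definition accepted (R : realType) (a b bt : nat)
    (L : 'M[R[i]]_b -> 'M[R[i]]_bt) (rho : 'M[R[i]]_(a * b)%N) :
    'M[R[i]]_((a + 1) * bt)%N :=
  tensmap (@accmx R a) (@idfun 'M_bt) (tensmap (@idfun 'M_a) L rho).

Definition DNS_authenticating (R : realType) (eps : R) (S : qes R) : Prop :=
  forall (b bt : nat)
    (L : {linear 'M[R[i]]_(dimC S * b)%N -> 'M[R[i]]_(dimC S * bt)%N}),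
  channel L ->
  exists Lacc Lrej : {linear 'M[R[i]]_b -> 'M[R[i]]_bt},
    [/\ cp_map Lacc,
        cp_map Lrej,
        forall X : 'M[R[i]]_b, \tr (Lacc X + Lrej X) = \tr X &
        forall rho : 'M[R[i]]_(dimA S * b)%N, state rho ->
          trnorm (ptrace2 (attacked L rho)
                  - (accepted Lacc rho
                     + Pbot R (dimA S) *t Lrej (ptrace1 rho))) <= eps].

Definition GYZ_authenticating (R : realType) (eps : R) (S : qes R) : Prop :=
  forall (b bt : nat)
    (L : {linear 'M[R[i]]_(dimC S * b)%N -> 'M[R[i]]_(dimC S * bt)%N}),
  channel L ->
  exists Lacc : {linear 'M[R[i]]_b -> 'M[R[i]]_bt},
    cp_map Lacc /\
    forall rho : 'M[R[i]]_(dimA S * b)%N, state rho ->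
      let P := Pacc R (dimA S) *t (1%:M : 'M_bt) *t (1%:M : 'M_(dimK S)) in
      trnorm (P *m attacked L rho *m P - accepted Lacc rho *t tauK S) <= eps.

(* Main.v *)
(* Write E and D for encryption and decryption, and let sigma(rho) be the
   ciphertext together with B, averaged over the key.

   Secrecy. Let W be a Hermitian unitary on C (x) B, and let the attack be the
   two-outcome instrument with Kraus operators proportional to 1 + h W and
   1 - h W, the outcome being recorded. Since D (E (rho)) is never rejected, the
   probability of rejection is minimal at h = 0, hence equals h^2 times a
   quantity in [0, 1]. Up to this, the probability of outcome "+" together with
   acceptance is 1/2 + h/(1 + h^2) tr(W sigma(rho)); by GYZ-authentication it
   depends on rho_B only, up to eps. With h = sqrt eps,
   this bounds the trace distance of sigma(rho) and sigma(rho') by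
   O(sqrt eps) whenever rho_B = rho'_B.

   Rejection. For any attack, the state of B~ on rejection is the marginal on B~
   of the attacked sigma(rho), minus the accepted part. The former depends on
   rho_B only by secrecy, the latter by GYZ-authentication. Hence the reject
   branch may be simulated by running the attack on |0><0| (x) rho_B. Together
   with the GYZ simulator this preserves the trace up to eps; dividing by
   1 + eps and adding the missing trace to the reject branch repairs it. *)

Require Import Defs.
From HB Require Import structures.
From mathcomp Require Import all_boot all_order all_algebra.
From mathcomp Require Import reals ring lra.

Set Implicit Arguments.
Unset Strict Implicit.
Unset Printing Implicit Defensive.

Import Order.TTheory GRing.Theory Num.Theory.
Local Open Scope ring_scope.
Local Open Scope complex_scope.
Local Open Scope sesquilinear_scope.

(** * Adjoints and positive semidefinite operators *)

Lemma adjmxM (C : numClosedFieldType) m n p (A : 'M[C]_(m, n)) (B : 'M_(n, p)) :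
  (A *m B)^t* = B^t* *m A^t*.
Proof. by rewrite trmx_mul map_mxM. Qed.

Lemma adjmxD (C : numClosedFieldType) m n (A B : 'M[C]_(m, n)) :
  (A + B)^t* = A^t* + B^t*.
Proof. by rewrite linearD map_mxD. Qed.

Lemma adjmxN (C : numClosedFieldType) m n (A : 'M[C]_(m, n)) :
  (- A)^t* = - A^t*.
Proof. by rewrite linearN map_mxN. Qed.

Lemma adjmxZ (C : numClosedFieldType) m n a (A : 'M[C]_(m, n)) :
  (a *: A)^t* = Num.conj a *: A^t*.
Proof. by rewrite linearZ map_mxZ. Qed.

Lemma adjmx1 (C : numClosedFieldType) n : (1%:M : 'M[C]_n)^t* = 1%:M.
Proof. by rewrite trmx1 map_mx1. Qed.

Lemma adjmx_delta (C : numClosedFieldType) m n i j :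
  (delta_mx i j : 'M[C]_(m, n))^t* = delta_mx j i.
Proof. by rewrite trmx_delta map_delta_mx. Qed.

Lemma adjmx_tens (C : numClosedFieldType) m n p q
    (A : 'M[C]_(m, n)) (B : 'M[C]_(p, q)) : (A *t B)^t* = A^t* *t B^t*.
Proof. by rewrite trmx_tens map_mxT. Qed.

Lemma adjmxE (C : numClosedFieldType) m n (A : 'M[C]_(m, n)) i j :
  (A^t*) i j = Num.conj (A j i).
Proof. by rewrite !mxE. Qed.

Lemma addmxE (V : nmodType) m n (A B : 'M[V]_(m, n)) i j :
  (A + B) i j = A i j + B i j.
Proof. by rewrite mxE. Qed.

Lemma scalemxE (T : pzRingType) m n a (A : 'M[T]_(m, n)) i j :
  (a *: A) i j = a * A i j.
Proof. by rewrite mxE. Qed.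

Lemma sqnorm_ge0 (C : numClosedFieldType) n (v : 'cV[C]_n) :
  0 <= (v^t* *m v) 0 0.
Proof.
rewrite mxE; apply: sumr_ge0 => i _.
by rewrite adjmxE mulrC mul_conjC_ge0.
Qed.

Lemma psd_conj (R : realType) m n (A : 'M[R[i]]_(m, n)) (X : 'M[R[i]]_n) :
  psd X -> psd (A *m X *m A^t*).
Proof.
move=> pX v; have := pX (A^t* *m v).
by rewrite adjmxM trmxCK !mulmxA.
Qed.

Lemma psd0 (R : realType) n : psd (0 : 'M[R[i]]_n).
Proof. by move=> v; rewrite mulmx0 mul0mx mxE. Qed.

Lemma psd1 (R : realType) n : psd (1%:M : 'M[R[i]]_n).
Proof. by move=> v; rewrite mulmx1 sqnorm_ge0. Qed.

Lemma psdD (R : realType) n (X Y : 'M[R[i]]_n) : psd X -> psd Y -> psd (X + Y).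
Proof. by move=> pX pY v; rewrite mulmxDr mulmxDl mxE addr_ge0. Qed.

Lemma psdZ (R : realType) n (a : R[i]) (X : 'M[R[i]]_n) :
  0 <= a -> psd X -> psd (a *: X).
Proof. by move=> a0 pX v; rewrite -scalemxAr -scalemxAl mxE mulr_ge0. Qed.

Lemma psd_sum (R : realType) n I (r : seq I) (F : I -> 'M[R[i]]_n) :
  (forall i, psd (F i)) -> psd (\sum_(i <- r) F i).
Proof.
move=> pF; elim: r => [|i r IH]; first by rewrite big_nil; exact: psd0.
by rewrite big_cons; exact: psdD.
Qed.

Lemma psd_gram (R : realType) m n (A : 'M[R[i]]_(m, n)) : psd (A *m A^t*).
Proof. by rewrite -[X in X *m _]mulmx1; apply: psd_conj; exact: psd1. Qed.

Lemma form_delta (R : realType) m n (A : 'M[R[i]]_(m, n)) i j :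
  ((delta_mx i 0 : 'cV_m)^t* *m A *m (delta_mx j 0 : 'cV_n)) 0 0 = A i j.
Proof. by rewrite adjmx_delta -rowE -colE !mxE. Qed.

Lemma psd_diag (R : realType) n (X : 'M[R[i]]_n) i : psd X -> 0 <= X i i.
Proof. by move=> /(_ (delta_mx i 0)); rewrite form_delta. Qed.

Lemma psd_trace_ge0 (R : realType) n (X : 'M[R[i]]_n) : psd X -> 0 <= \tr X.
Proof. by move=> pX; apply: sumr_ge0 => i _; apply: psd_diag. Qed.

(* Polarization: the form is real at [e_i + e_j] and at [e_i + 'i e_j]. *)
Lemma psd_herm (R : realType) n (X : 'M[R[i]]_n) : psd X -> X^t* = X.
Proof.
move=> pX; apply/matrixP => i j; rewrite adjmxE.
have re k : Num.conj (X k k) = X k k.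
  by apply/CrealP; rewrite ger0_real ?psd_diag.
have pol (c : R[i]) :
    Num.conj (c * X i j + Num.conj c * X j i) = c * X i j + Num.conj c * X j i.
  have := pX (delta_mx i 0 + c *: delta_mx j 0).
  rewrite adjmxD adjmxZ !mulmxDl !mulmxDr -!(scalemxAl, scalemxAr).
  rewrite !addmxE !scalemxE !form_delta.
  move=> /ger0_real /CrealP; rewrite !(rmorphD, rmorphM) /= !conjCK !re => h.
  apply: (addrI (X i i)); apply: (addIr (Num.conj c * (c * X j j))).
  rewrite -!addrA !(mulrCA (Num.conj c) c) in h *.
  move: h; rewrite !addrA => h; apply: etrans (etrans h _); ring.
(* With [c] equal to 1 and to the imaginary unit, both a + b and i (a - b) are real for a = X i j
   and b = X j i; together these say that the conjugate of b is a. *)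
have h1 := pol 1; have h2 := pol 'i%R.
move: h1 h2; rewrite !(rmorphD, rmorphM) /= !conjCK conjC1 !conjCi !mul1r.
set a := X i j; set b := X j i => h1 h2.
have ii : 'i%R * 'i%R = -1 :> R[i] by rewrite -expr2 sqrCi.
have h3 : Num.conj b - Num.conj a = a - b.
  have := congr1 (fun z => - ('i%R * z)) h2.
  rewrite !mulrDr !mulNr !mulrN !mulrA ii => h3.
  by apply: etrans (etrans h3 _); ring.
have h4 : 2%:R * Num.conj b = 2%:R * a.
  have -> : 2%:R * Num.conj b
    = (Num.conj a + Num.conj b) + (Num.conj b - Num.conj a) by ring.
  by rewrite h1 h3; ring.
by move/mulfI: h4 => -> //; rewrite pnatr_eq0.
Qed.

(** * Duality for the trace norm *)

(** The eigenvalues of a Hermitian matrix are real, so [d] can be taken over [R] and compared by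
    order and absolute value. *)
Lemma spectral_decomp (R : realType) n (X : 'M[R[i]]_n) : X^t* = X ->
  exists (U : 'M[R[i]]_n) (d : 'rV[R]_n),
    [/\ U *m U^t* = 1%:M, U^t* *m U = 1%:M
      & X = U^t* *m diag_mx (map_mx (real_complex R) d) *m U].
Proof.
move=> hX; have hs : X \is hermsymmx.
  by apply/is_hermitianmxP; rewrite expr0 scale1r hX.
have /orthomx_spectralP := hermitian_normalmx hs.
have uU := spectral_unitarymx X.
rewrite invmx_unitary // => XE.
exists (spectralmx X), (map_mx (@complex.Re R) (spectral_diag X)); split.
- exact/unitarymxP.
- by rewrite -invmx_unitary // mulVmx // unitarymx_unit.
- suff -> : map_mx (real_complex R) (map_mx (@complex.Re R) (spectral_diag X))
      = spectral_diag X by exact: XE.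
  apply/rowP => j; rewrite !mxE.
  have /mxOverP /(_ 0 j) := hermitian_spectral_diag_real hs.
  by move/RRe_real.
Qed.

(** This is -1 <= N <= 1 in the Loewner order. Such an [N] is Hermitian, and these operators form
    the unit ball dual to the trace norm on Hermitian operators. *)
Definition contr (R : realType) n (N : 'M[R[i]]_n) : Prop :=
  psd (1%:M - N) /\ psd (1%:M + N).

(** For Hermitian [N] and [X] the trace is real already; the real part only moves its value into the
    ordered field [R]. *)
Definition trpair (R : realType) n (N X : 'M[R[i]]_n) : R :=
  complex.Re (\tr (N *m X)).

Lemma ReD (R : realType) (x y : R[i]) :
  complex.Re (x + y) = complex.Re x + complex.Re y.
Proof. by case: x y => ? ? []. Qed.

Lemma ReN (R : realType) (x : R[i]) : complex.Re (- x) = - complex.Re x.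
Proof. by case: x. Qed.

Lemma ReZ (R : realType) (a : R) (x : R[i]) :
  complex.Re (a%:C * x) = a * complex.Re x.
Proof. by case: x => b c /=; rewrite mul0r subr0. Qed.

Lemma Re_ge0 (R : realType) (x : R[i]) : 0 <= x -> 0 <= complex.Re x.
Proof. by rewrite lecE => /andP[]. Qed.

Lemma trpairDl (R : realType) n (N M X : 'M[R[i]]_n) :
  trpair (N + M) X = trpair N X + trpair M X.
Proof. by rewrite /trpair mulmxDl linearD /= ReD. Qed.

Lemma trpairDr (R : realType) n (N X Y : 'M[R[i]]_n) :
  trpair N (X + Y) = trpair N X + trpair N Y.
Proof. by rewrite /trpair mulmxDr linearD /= ReD. Qed.

Lemma trpairNl (R : realType) n (N X : 'M[R[i]]_n) : trpair (- N) X = - trpair N X.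
Proof. by rewrite /trpair mulNmx linearN /= ReN. Qed.

Lemma trpairNr (R : realType) n (N X : 'M[R[i]]_n) : trpair N (- X) = - trpair N X.
Proof. by rewrite /trpair mulmxN linearN /= ReN. Qed.

Lemma trpairZl (R : realType) n (a : R) (N X : 'M[R[i]]_n) :
  trpair (a%:C *: N) X = a * trpair N X.
Proof. by rewrite /trpair -scalemxAl linearZ /= ReZ. Qed.

Lemma trpairZr (R : realType) n (a : R) (N X : 'M[R[i]]_n) :
  trpair N (a%:C *: X) = a * trpair N X.
Proof. by rewrite /trpair -scalemxAr linearZ /= ReZ. Qed.

Lemma conj_real_complex (R : realType) (x : R) : Num.conj (x%:C) = x%:C.
Proof. by apply/CrealP; rewrite complex_real. Qed.

(* The positive square root is unique: if [L Z = Z D^2] entrywise with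
   [L >= 0], then [sqrt L Z = Z |D|] entrywise. *)
Lemma trnorm_spectral (R : realType) n (X U : 'M[R[i]]_n) (d : 'rV[R]_n) :
    U *m U^t* = 1%:M -> U^t* *m U = 1%:M ->
    X = U^t* *m diag_mx (map_mx (real_complex R) d) *m U ->
  trnorm X = \sum_j `|d 0 j|.
Proof.
move=> UU' U'U XE; rewrite /trnorm /absmx.
set H := X^t* *m X.
set W := spectralmx H; set l := spectral_diag H.
have HE : H = U^t* *m diag_mx (map_mx (fun x => (x ^+ 2)%:C) d) *m U.
  rewrite /H XE !adjmxM trmxCK tr_diag_mx map_diag_mx -!mulmxA.
  rewrite [U *m (_ *m _)]mulmxA UU' mul1mx; congr (_ *m _).
  rewrite !mulmxA mulmx_diag; congr (diag_mx _ *m _); apply/rowP => j.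
  rewrite !mxE.
  by apply: etrans (congr1 ( *%R^~ _) (conj_real_complex _)) _; rewrite -rmorphM.
have hH : H \is hermsymmx.
  by apply/is_hermitianmxP; rewrite expr0 scale1r /H adjmxM trmxCK.
have uW : W \is unitarymx by exact: spectral_unitarymx.
have WW' : W *m W^t* = 1%:M by apply/unitarymxP.
have W'W : W^t* *m W = 1%:M by rewrite -invmx_unitary // mulVmx // unitarymx_unit.
have /orthomx_spectralP := hermitian_normalmx hH.
rewrite -/W -/l invmx_unitary // => HW.
(* [Z] passes from the eigenbasis [U] of [X] to the eigenbasis [W] that [absmx] uses, and it
   intertwines the two diagonal forms of [H]. *)
have [Z [ZZ' Z'Z ZE]] : exists Z : 'M[R[i]]_n,
    [/\ Z *m Z^t* = 1%:M, Z^t* *m Z = 1%:M & diag_mx l *m Z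
        = Z *m diag_mx (map_mx (fun x => (x ^+ 2)%:C) d)].
  exists (W *m U^t*); split.
  - by rewrite adjmxM trmxCK mulmxA -(mulmxA W) U'U mulmx1.
  - by rewrite adjmxM trmxCK mulmxA -(mulmxA U) W'W mulmx1.
  - have := congr1 (fun M => W *m M *m U^t*) HW.
    rewrite {1}HE -!mulmxA UU' mulmx1.
    by rewrite (mulmxA W (W^t*)) WW' mul1mx !mulmxA => ->.
have SE : diag_mx (map_mx sqrtC l) *m Z
    = Z *m diag_mx (map_mx (fun x => `|x|%:C) d).
  apply/matrixP => i j; have /matrixP /(_ i j) := ZE.
  rewrite !mul_diag_mx !mul_mx_diag !mxE => zE.
  have [->|z0] := eqVneq (Z i j) 0; first by rewrite mulr0 mul0r.
  have -> : l 0 i = (`|d 0 j|%:C) ^+ 2.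
    apply: (mulIf z0); rewrite zE mulrC -rmorphXn /=.
    by rewrite real_normK ?num_real.
  by rewrite sqrCK 1?mulrC // ler0c.
rewrite mxtrace_mulC mulmxA WW' mul1mx -[diag_mx _]mulmx1 -ZZ' mulmxA SE.
rewrite -mulmxA mxtrace_mulC -mulmxA Z'Z mulmx1 mxtrace_diag.
under eq_bigr do rewrite mxE.
by rewrite -raddf_sum.
Qed.

(* [N = U^* sign(D) U] for [X = U^* D U]. *)
Lemma trnorm_attained (R : realType) n (X : 'M[R[i]]_n) : X^t* = X ->
  exists N : 'M[R[i]]_n,
    [/\ N^t* = N, N *m N = 1%:M & trnorm X = trpair N X].
Proof.
move=> /spectral_decomp [U [d [UU' U'U XE]]].
pose s : 'rV[R[i]]_n := map_mx (fun x : R => (if 0 <= x then 1 else -1 : R)%:C) d.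
exists (U^t* *m diag_mx s *m U); split.
- rewrite !adjmxM trmxCK tr_diag_mx map_diag_mx mulmxA; congr (_ *m diag_mx _ *m _).
  by apply/rowP => j; rewrite !mxE; exact: conj_real_complex.
- rewrite !mulmxA -(mulmxA _ U) UU' mulmx1 -(mulmxA (U^t*) (diag_mx s)) mulmx_diag.
  rewrite (_ : \row_i _ = const_mx 1) ?diag_const_mx ?mulmx1 //.
  by apply/rowP => j; rewrite !mxE -rmorphM; case: ifP; rewrite ?mulrNN mul1r.
- rewrite (trnorm_spectral UU' U'U XE) /trpair XE !mulmxA -(mulmxA _ U) UU' mulmx1.
  rewrite mxtrace_mulC !mulmxA UU' mul1mx mulmx_diag mxtrace_diag.
  under [X in complex.Re X]eq_bigr do rewrite !mxE -rmorphM /=.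
  rewrite -raddf_sum /=; apply: eq_bigr => j _.
  by case: ifP => [/ger0_norm->|]; rewrite ?mul1r // mulN1r => /negbT;
    rewrite -ltNge => /ltr0_norm.
Qed.

Lemma contr_conj (R : realType) m n (U : 'M[R[i]]_(m, n)) (N : 'M[R[i]]_n) :
  U *m U^t* = 1%:M -> contr N -> contr (U *m N *m U^t*).
Proof.
move=> UU [h1 h2]; split.
  by have := psd_conj U h1; rewrite mulmxBr mulmxBl mulmx1 UU.
by have := psd_conj U h2; rewrite mulmxDr mulmxDl mulmx1 UU.
Qed.

Lemma contr_diag (R : realType) n (N : 'M[R[i]]_n) j : contr N ->
  `|complex.Re (N j j)| <= 1.
Proof.
case=> /(@psd_diag _ _ _ j) + /(@psd_diag _ _ _ j).
rewrite !mxE eqxx => /Re_ge0 + /Re_ge0; rewrite !ReD ReN /= => h1 h2.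
by rewrite ler_norml; lra.
Qed.

(** In the eigenbasis of [X] the pairing is the sum of the eigenvalues weighted by the diagonal
    entries of the rotated [N], each in [-1, 1]. *)
Lemma trpair_le_trnorm (R : realType) n (N X : 'M[R[i]]_n) :
  X^t* = X -> contr N -> trpair N X <= trnorm X.
Proof.
move=> /spectral_decomp [U [d [UU' U'U XE]]] cN.
rewrite (trnorm_spectral UU' U'U XE) /trpair {1}XE !mulmxA mxtrace_mulC !mulmxA.
set D := diag_mx _; have /contr_conj := UU' => /(_ _ cN).
set M := _ *m _ => cM; rewrite /mxtrace raddf_sum /=; apply: ler_sum => j _.
rewrite mul_mx_diag !mxE mulrC ReZ.
apply: le_trans (ler_norm _) _; rewrite normrM ler_piMr //.
by have := contr_diag j cM; rewrite mxE.
Qed.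

Lemma contrN (R : realType) n (N : 'M[R[i]]_n) : contr N -> contr (- N).
Proof. by case=> h1 h2; split; rewrite ?opprK. Qed.

(** Since N^2 = 1, the square of 1 + N is 2 (1 + N), so 1 + N is half the square of a Hermitian
    matrix; the same holds for -N. *)
Lemma contr_reflection (R : realType) n (N : 'M[R[i]]_n) :
  N^t* = N -> N *m N = 1%:M -> contr N.
Proof.
move=> hN NN; have half : (0 : R[i]) <= 2%:R^-1 by rewrite invr_ge0 ler0n.
have sq (M : 'M[R[i]]_n) : M^t* = M -> M *m M = 1%:M -> psd (1%:M + M).
  move=> hM MM; have := psdZ half (psd_gram (1%:M + M)).
  rewrite adjmxD adjmx1 hM mulmxDr !mulmxDl !mulmx1 !mul1mx MM [M + 1%:M]addrC.
  by rewrite -mulr2n -[X in _ *: X]scaler_nat scalerA mulVf ?scale1r // pnatr_eq0.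
by split; apply: sq; rewrite ?adjmxN ?hN // mulNmx mulmxN opprK.
Qed.

(** The eigenvalues are nonnegative, as diagonal entries of the rotated [X], and the factor is U^*
    times their square roots. *)
Lemma psd_factor (R : realType) n (X : 'M[R[i]]_n) : psd X ->
  exists V : 'M[R[i]]_n, X = V *m V^t*.
Proof.
move=> /[dup] /psd_herm /spectral_decomp [U [d [UU' U'U XE]]] pX.
have d0 j : 0 <= d 0 j.
  have := @psd_diag _ _ _ j (psd_conj U pX); rewrite XE !mulmxA UU' mul1mx.
  by rewrite -mulmxA UU' mulmx1 !mxE eqxx mulr1n ler0c.
pose D : 'M[R[i]]_n := diag_mx (map_mx (fun x => (Num.sqrt x)%:C) d).
have DD : D *m D^t* = diag_mx (map_mx (real_complex R) d).
  rewrite /D tr_diag_mx map_diag_mx mulmx_diag; congr diag_mx.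
  apply/rowP => j; rewrite !mxE.
  apply: etrans (congr1 ( *%R _) (conj_real_complex _)) _.
  by rewrite -rmorphM /= -expr2 sqr_sqrtr.
exists (U^t* *m D); rewrite adjmxM trmxCK mulmxA -(mulmxA _ D) DD; exact: XE.
Qed.

Lemma trpair_psd_ge0 (R : realType) n (N X : 'M[R[i]]_n) :
  psd N -> psd X -> 0 <= trpair N X.
Proof.
move=> pN /psd_factor [V ->]; apply: Re_ge0.
rewrite mulmxA mxtrace_mulC mulmxA; apply: psd_trace_ge0.
by have := psd_conj (V^t*) pN; rewrite trmxCK.
Qed.

Lemma trpair1 (R : realType) n (X : 'M[R[i]]_n) : trpair 1%:M X = complex.Re (\tr X).
Proof. by rewrite /trpair mul1mx. Qed.

Lemma trpair_contr_psd (R : realType) n (N X : 'M[R[i]]_n) :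
  contr N -> psd X -> trpair N X <= complex.Re (\tr X).
Proof.
move=> [h _] pX; have := trpair_psd_ge0 h pX.
by rewrite trpairDl trpairNl trpair1; lra.
Qed.

(** For X = V V^* the trace is the sum of all squared moduli of entries of [V]. *)
Lemma psd_trace0 (R : realType) n (X : 'M[R[i]]_n) : psd X -> \tr X = 0 -> X = 0.
Proof.
move=> /psd_factor [V ->] t0; suff -> : V = 0 by rewrite mul0mx.
apply/matrixP => i j; rewrite mxE.
have pos k l : 0 <= V k l * Num.conj (V k l) by exact: mul_conjC_ge0.
have : \sum_k \sum_l V k l * Num.conj (V k l) = 0.
  rewrite -[RHS]t0; apply: eq_bigr => k _; rewrite mxE; apply: eq_bigr => l _.
  by rewrite adjmxE.
move/eqP; rewrite psumr_eq0 => [/allP /(_ i)|k _]; last exact: sumr_ge0.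
rewrite mem_index_enum psumr_eq0 // => /(_ isT) /allP /(_ j).
by rewrite mem_index_enum mul_conjC_eq0 => /(_ isT) /eqP.
Qed.

(** * Tensor products and Kraus maps *)

Lemma tensmxDl (T : pzRingType) m n p q (A B : 'M[T]_(m, n)) (X : 'M[T]_(p, q)) :
  (A + B) *t X = A *t X + B *t X.
Proof. by apply/matrixP => i j; rewrite !mxE mulrDl. Qed.

Lemma tensmxDr (T : pzRingType) m n p q (A B : 'M[T]_(m, n)) (X : 'M[T]_(p, q)) :
  X *t (A + B) = X *t A + X *t B.
Proof. by apply/matrixP => i j; rewrite !mxE mulrDr. Qed.

Lemma tensmxZl (T : pzRingType) m n p q a (A : 'M[T]_(m, n)) (X : 'M[T]_(p, q)) :
  (a *: A) *t X = a *: (A *t X).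
Proof. by apply/matrixP => i j; rewrite !mxE mulrA. Qed.

Lemma tensmxZr (T : comPzRingType) m n p q a (A : 'M[T]_(m, n)) (X : 'M[T]_(p, q)) :
  X *t (a *: A) = a *: (X *t A).
Proof. by apply/matrixP => i j; rewrite !mxE mulrCA. Qed.

Lemma tensmx_suml (T : pzRingType) m n p q I (r : seq I) (F : I -> 'M[T]_(m, n))
  (X : 'M[T]_(p, q)) : (\sum_(i <- r) F i) *t X = \sum_(i <- r) F i *t X.
Proof.
by apply: (big_morph (fun A => A *t X)) => [A B|]; rewrite ?tens0mx ?tensmxDl.
Qed.

Lemma tensmx_sumr (T : pzRingType) m n p q I (r : seq I) (F : I -> 'M[T]_(m, n))
  (X : 'M[T]_(p, q)) : X *t (\sum_(i <- r) F i) = \sum_(i <- r) X *t F i.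
Proof.
by apply: (big_morph (fun A => X *t A)) => [A B|]; rewrite ?tensmx0 ?tensmxDr.
Qed.

Lemma tensmx11 (T : pzRingType) m n : (1%:M : 'M[T]_m) *t (1%:M : 'M[T]_n) = 1%:M.
Proof.
apply/matrixP => i j; case: (mxtens_indexP i) => i1 i2.
case: (mxtens_indexP j) => j1 j2; rewrite tensmxE !mxE -natrM mulnb.
by rewrite (can_eq (@mxtens_indexK m n)).
Qed.

Lemma sum_mxtens (V : nmodType) m n (F : 'I_(m * n) -> V) :
  \sum_x F x = \sum_(i < m) \sum_(j < n) F (mxtens_index (i, j)).
Proof.
rewrite pair_big /= (reindex (@mxtens_index m n)) /=; last first.
  exists (@mxtens_unindex m n) => x _; first exact: mxtens_indexK.
  exact: mxtens_unindexK.
by apply: eq_bigr => [[]].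
Qed.

Lemma trace_tens (T : pzRingType) m n (A : 'M[T]_m) (B : 'M[T]_n) :
  \tr (A *t B) = \tr A * \tr B.
Proof.
rewrite /mxtrace sum_mxtens mulr_suml; apply: eq_bigr => i _.
by rewrite mulr_sumr; apply: eq_bigr => j _; rewrite tensmxE.
Qed.

Lemma tensmap_is_linear (R : realType) (m m' n n' : nat)
    (f : 'M[R[i]]_m -> 'M[R[i]]_m') (g : 'M[R[i]]_n -> 'M[R[i]]_n') :
  linear (tensmap f g).
Proof.
move=> c X Y; rewrite /tensmap scaler_sumr -big_split; apply: eq_bigr => i _ /=.
rewrite scaler_sumr -big_split; apply: eq_bigr => j _ /=.
rewrite scaler_sumr -big_split; apply: eq_bigr => k _ /=.
rewrite scaler_sumr -big_split; apply: eq_bigr => l _ /=.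
by rewrite !mxE scalerDl scalerA.
Qed.
HB.instance Definition _ (R : realType) (m m' n n' : nat)
    (f : 'M[R[i]]_m -> 'M[R[i]]_m') (g : 'M[R[i]]_n -> 'M[R[i]]_n') :=
  GRing.isLinear.Build R[i] 'M[R[i]]_(m * n) 'M[R[i]]_(m' * n') _ (tensmap f g)
    (tensmap_is_linear f g).

Lemma swapmx_is_linear (R : realType) (m n p : nat) : linear (@swapmx R m n p).
Proof. by move=> c X Y; apply/matrixP => i j; rewrite !mxE. Qed.
HB.instance Definition _ (R : realType) (m n p : nat) :=
  GRing.isLinear.Build R[i] 'M[R[i]]_(m * n * p) 'M[R[i]]_(m * p * n) _
    (@swapmx R m n p) (@swapmx_is_linear R m n p).

Lemma ptrace1_is_linear (R : realType) (m n : nat) : linear (@ptrace1 R m n).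
Proof.
move=> c X Y; apply/matrixP => i j; rewrite !mxE mulr_sumr -big_split.
by apply: eq_bigr => k _; rewrite !mxE.
Qed.
HB.instance Definition _ (R : realType) (m n : nat) :=
  GRing.isLinear.Build R[i] 'M[R[i]]_(m * n) 'M[R[i]]_n _
    (@ptrace1 R m n) (@ptrace1_is_linear R m n).

Lemma ptrace2_is_linear (R : realType) (m n : nat) : linear (@ptrace2 R m n).
Proof.
move=> c X Y; apply/matrixP => i j; rewrite !mxE mulr_sumr -big_split.
by apply: eq_bigr => k _; rewrite !mxE.
Qed.
HB.instance Definition _ (R : realType) (m n : nat) :=
  GRing.isLinear.Build R[i] 'M[R[i]]_(m * n) 'M[R[i]]_m _
    (@ptrace2 R m n) (@ptrace2_is_linear R m n).

Lemma ptrace1_tens (R : realType) m n (A : 'M[R[i]]_m) (B : 'M[R[i]]_n) :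
  ptrace1 (A *t B) = \tr A *: B.
Proof.
apply/matrixP => i j; rewrite !mxE mulr_suml.
by apply: eq_bigr => k _; rewrite tensmxE.
Qed.

Lemma ptrace2_tens (R : realType) m n (A : 'M[R[i]]_m) (B : 'M[R[i]]_n) :
  ptrace2 (A *t B) = \tr B *: A.
Proof.
apply/matrixP => i j; rewrite !mxE mulr_suml.
by apply: eq_bigr => k _; rewrite tensmxE mulrC.
Qed.

Lemma eq_tensmap (R : realType) (m m' n n' : nat)
    (f f' : 'M[R[i]]_m -> 'M[R[i]]_m') (g g' : 'M[R[i]]_n -> 'M[R[i]]_n') :
  f =1 f' -> g =1 g' -> tensmap f g =1 tensmap f' g'.
Proof.
move=> ff gg X; apply: eq_bigr => i _; apply: eq_bigr => j _.
by apply: eq_bigr => k _; apply: eq_bigr => l _; rewrite ff gg.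
Qed.

Lemma tens_sum_delta (R : realType) m n (X : 'M[R[i]]_(m * n)) :
  X = \sum_i \sum_j \sum_k \sum_l
    X (mxtens_index (i, k)) (mxtens_index (j, l)) *: (delta_mx i j *t delta_mx k l).
Proof.
have dlt (i j : 'I_m) (k l : 'I_n) : delta_mx i j *t delta_mx k l
    = delta_mx (mxtens_index (i, k)) (mxtens_index (j, l)) :> 'M[R[i]]_(m * n).
  apply/matrixP => x y; case: (mxtens_indexP x) => a b.
  case: (mxtens_indexP y) => c d; rewrite tensmxE !mxE -natrM mulnb.
  by rewrite !(can_eq (@mxtens_indexK m n)) !xpair_eqE andbACA.
rewrite {1}[X]matrix_sum_delta sum_mxtens; apply: eq_bigr => i _.
under eq_bigr do rewrite sum_mxtens.
rewrite exchange_big; apply: eq_bigr => j _.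
by apply: eq_bigr => k _; apply: eq_bigr => l _; rewrite dlt.
Qed.

(** Product operators span the operators on a tensor product. Linearity is asked of bare functions,
    so that composites can be compared directly. *)
Lemma tens_ext (R : realType) m n (V : lmodType R[i])
    (f g : 'M[R[i]]_(m * n) -> V) : linear f -> linear g ->
  (forall A B, f (A *t B) = g (A *t B)) -> f =1 g.
Proof.
move=> lf lg fg X.
pose F : {linear _ -> _} := HB.pack f (GRing.isLinear.Build _ _ _ _ f lf).
pose G : {linear _ -> _} := HB.pack g (GRing.isLinear.Build _ _ _ _ g lg).
change (F X = G X); rewrite [X]tens_sum_delta !linear_sum; apply: eq_bigr => i _.
rewrite !linear_sum; apply: eq_bigr => j _; rewrite !linear_sum.
apply: eq_bigr => k _; rewrite !linear_sum; apply: eq_bigr => l _.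
by rewrite !linearZ /= fg.
Qed.

Lemma delta_ext (R : realType) m n (V : lmodType R[i])
    (f g : 'M[R[i]]_(m, n) -> V) : linear f -> linear g ->
  (forall i j, f (delta_mx i j) = g (delta_mx i j)) -> f =1 g.
Proof.
move=> lf lg fg X.
pose F : {linear _ -> _} := HB.pack f (GRing.isLinear.Build _ _ _ _ f lf).
pose G : {linear _ -> _} := HB.pack g (GRing.isLinear.Build _ _ _ _ g lg).
change (F X = G X); rewrite [X]matrix_sum_delta !linear_sum; apply: eq_bigr => i _.
by rewrite !linear_sum; apply: eq_bigr => j _; rewrite !linearZ /= fg.
Qed.

Lemma trM_delta (R : realType) m n (M : 'M[R[i]]_(m, n)) i j :
  \tr (M *m delta_mx j i) = M i j.
Proof.
rewrite -[delta_mx j i](mul_delta_mx (0 : 'I_1)) mulmxA mxtrace_mulC mulmxA.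
by rewrite trace_mx11 -rowE -colE !mxE.
Qed.

Definition kraus_map (R : realType) m n (s : seq 'M[R[i]]_(n, m)) (X : 'M[R[i]]_m) :
  'M[R[i]]_n := \sum_(A <- s) A *m X *m A^t*.

Lemma kraus_map_is_linear (R : realType) m n (s : seq 'M[R[i]]_(n, m)) :
  linear (kraus_map s).
Proof.
move=> c X Y; rewrite /kraus_map scaler_sumr -big_split; apply: eq_bigr => A _ /=.
by rewrite mulmxDr mulmxDl scalemxAl scalemxAr.
Qed.
HB.instance Definition _ (R : realType) m n (s : seq 'M[R[i]]_(n, m)) :=
  GRing.isLinear.Build R[i] 'M[R[i]]_m 'M[R[i]]_n _ (kraus_map s)
    (kraus_map_is_linear s).

(** By [cp_map_kraus] and [kraus_cp_map] this is complete positivity. Stated for bare functions, it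
    is closed under composition, sums and tensoring with the identity, and it yields linearity. *)
Definition kraus (R : realType) m n (f : 'M[R[i]]_m -> 'M[R[i]]_n) : Prop :=
  exists s : seq 'M[R[i]]_(n, m), f =1 kraus_map s.

Lemma kraus_ext (R : realType) m n (f g : 'M[R[i]]_m -> 'M[R[i]]_n) :
  f =1 g -> kraus g -> kraus f.
Proof. by move=> fg [s gs]; exists s => X; rewrite fg. Qed.

Lemma kraus_linear (R : realType) m n (f : 'M[R[i]]_m -> 'M[R[i]]_n) :
  kraus f -> linear f.
Proof. by case=> s fs c X Y; rewrite !fs linearP. Qed.

Lemma kraus_psd (R : realType) m n (f : 'M[R[i]]_m -> 'M[R[i]]_n) X :
  kraus f -> psd X -> psd (f X).
Proof. by case=> s -> pX; apply: psd_sum => A; exact: psd_conj. Qed.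

Lemma kraus_conj (R : realType) m n (A : 'M[R[i]]_(n, m)) :
  kraus (fun X => A *m X *m A^t*).
Proof. by exists [:: A] => X; rewrite /kraus_map big_seq1. Qed.

Lemma kraus_add (R : realType) m n (f g : 'M[R[i]]_m -> 'M[R[i]]_n) :
  kraus f -> kraus g -> kraus (fun X => f X + g X).
Proof.
by move=> [s fs] [t gt]; exists (s ++ t) => X; rewrite fs gt /kraus_map big_cat.
Qed.

Lemma kraus_sum (R : realType) m n I (r : seq I)
    (F : I -> 'M[R[i]]_m -> 'M[R[i]]_n) :
  (forall i, kraus (F i)) -> kraus (fun X => \sum_(i <- r) F i X).
Proof.
move=> kF; elim: r => [|i r IH].
  by exists [::] => X; rewrite /kraus_map !big_nil.
by apply: kraus_ext (kraus_add (kF i) IH) => X; rewrite big_cons.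
Qed.

Lemma kraus_comp (R : realType) m n p (f : 'M[R[i]]_n -> 'M[R[i]]_p)
    (g : 'M[R[i]]_m -> 'M[R[i]]_n) : kraus f -> kraus g -> kraus (fun X => f (g X)).
Proof.
case=> s fs [t gt].
suff: kraus (fun X => \sum_(A <- s) \sum_(B <- t)
    (A *m B) *m X *m (A *m B)^t*).
  apply: kraus_ext => X; rewrite fs gt /kraus_map; apply: eq_bigr => A _.
  rewrite mulmx_sumr mulmx_suml; apply: eq_bigr => B _.
  by rewrite adjmxM !mulmxA.
by apply: kraus_sum => A; apply: kraus_sum => B; exact: kraus_conj.
Qed.

Lemma kraus_scale (R : realType) m n (c : R[i]) (f : 'M[R[i]]_m -> 'M[R[i]]_n) :
  0 <= c -> kraus f -> kraus (fun X => c *: f X).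
Proof.
move=> c0 [s fs]; exists [seq sqrtC c *: A | A <- s] => X.
rewrite fs /kraus_map big_map scaler_sumr; apply: eq_bigr => A _.
rewrite adjmxZ -!scalemxAl -scalemxAr scalerA; congr (_ *: _).
have /CrealP -> : sqrtC c \is Num.real by rewrite ger0_real // sqrtC_ge0.
by rewrite -expr2 sqrtCK.
Qed.

(** Reindexing is conjugation by a 0/1 matrix. This covers the swaps of tensor factors and the
    single terms of a partial trace. *)
Lemma kraus_mxsub (R : realType) m n (f : 'I_n -> 'I_m) :
  kraus (fun X : 'M[R[i]]_m => mxsub f f X).
Proof.
apply: kraus_ext (kraus_conj (\matrix_(i, j) (f i == j)%:R)) => X.
apply/matrixP => i j; rewrite !mxE (bigD1 (f j)) //= big1 => [|k /negPf kj].
  rewrite !mxE eqxx (rmorph1 (Num.conj : R[i] -> R[i])) mulr1 addr0.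
  rewrite (bigD1 (f i)) //= big1 => [|k /negPf ki]; first by rewrite !mxE eqxx mul1r addr0.
  by rewrite !mxE eq_sym ki mul0r.
by rewrite !mxE eq_sym kj (rmorph0 (Num.conj : R[i] -> R[i])) mulr0.
Qed.

Lemma kraus_swapmx (R : realType) m n p : kraus (@swapmx R m n p).
Proof. exact: kraus_mxsub. Qed.

Lemma kraus_tensmap1 (R : realType) r m n (f : 'M[R[i]]_m -> 'M[R[i]]_n) :
  kraus f -> kraus (tensmap (@idfun 'M[R[i]]_r) f).
Proof.
case=> s fs; exists [seq 1%:M *t A | A <- s] => X.
rewrite (eq_tensmap (fun=> erefl) fs); move: X.
apply: tens_ext (tensmap_is_linear _ _) (kraus_map_is_linear _) _ => A B.
rewrite tensmapE /= /kraus_map big_map tensmx_sumr; apply: eq_bigr => C _.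
by rewrite adjmx_tens !tensmx_mul adjmx1 mul1mx mulmx1.
Qed.

Lemma kraus_tensmap2 (R : realType) r m n (f : 'M[R[i]]_m -> 'M[R[i]]_n) :
  kraus f -> kraus (tensmap f (@idfun 'M[R[i]]_r)).
Proof.
case=> s fs; exists [seq A *t 1%:M | A <- s] => X.
rewrite (eq_tensmap fs (fun=> erefl)); move: X.
apply: tens_ext (tensmap_is_linear _ _) (kraus_map_is_linear _) _ => A B.
rewrite tensmapE /= /kraus_map big_map tensmx_suml; apply: eq_bigr => C _.
by rewrite adjmx_tens !tensmx_mul adjmx1 mul1mx mulmx1.
Qed.

Lemma cp_map_kraus (R : realType) m n (f : {linear 'M[R[i]]_m -> 'M[R[i]]_n}) :
  kraus f -> cp_map f.
Proof. by move=> kf r X; apply: kraus_psd; exact: kraus_tensmap1. Qed.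

(* Choi: the columns of a square root of the Choi matrix, reshaped, are Kraus
   operators. *)
Lemma kraus_cp_map (R : realType) m n (f : {linear 'M[R[i]]_m -> 'M[R[i]]_n}) :
  cp_map f -> kraus f.
Proof.
move=> cf.
(* [w] is the unnormalized maximally entangled vector, so that applying [f] to half of w w^* gives
   the Choi matrix. *)
pose w : 'M[R[i]]_(m * m, 1 * 1) :=
  \sum_(i < m) (delta_mx i 0 : 'cV_m) *t (delta_mx i 0 : 'cV_m).
have wE : w *m w^t* = \sum_i \sum_j delta_mx i j *t delta_mx i j.
  rewrite mulmx_suml; apply: eq_bigr => i _.
  rewrite /w raddf_sum raddf_sum /= mulmx_sumr; apply: eq_bigr => j _.
  by rewrite adjmx_tens !adjmx_delta tensmx_mul !mul_delta_mx.
have /psd_factor [V VE] := cf m _ (psd_gram w).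
pose K (l : 'I_(m * n)) : 'M[R[i]]_(n, m) := \matrix_(x, i) V (mxtens_index (i, x)) l.
have fE i j : f (delta_mx i j) = \sum_l K l *m delta_mx i j *m (K l)^t*.
  apply/matrixP => x y.
  have /matrixP /(_ (mxtens_index (i, x)) (mxtens_index (j, y))) := VE.
  rewrite wE !linear_sum summxE (bigD1 i) //= [X in _ + X]big1 => [|i' /negPf ii']; last first.
    rewrite linear_sum summxE big1 // => j' _.
    by rewrite /= tensmapE tensmxE !mxE eq_sym ii' mul0r.
  rewrite addr0 linear_sum summxE (bigD1 j) //= big1 => [|j' /negPf jj']; last first.
    by rewrite /= tensmapE tensmxE !mxE (eq_sym j) jj' andbF mul0r.
  rewrite addr0 tensmapE tensmxE mxE !eqxx mul1r => ->.
  rewrite mxE summxE; apply: eq_bigr => l _.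
  rewrite [RHS]mxE (bigD1 j) //= big1 => [|j' /negPf jj']; last first.
    rewrite mxE big1 ?mul0r // => i' _.
    by rewrite [delta_mx _ _ _ _]mxE jj' andbF mulr0.
  rewrite addr0 [(_ *m delta_mx _ _) _ _]mxE (bigD1 i) //= big1; last first.
    by move=> i' /negPf ii'; rewrite [delta_mx _ _ _ _]mxE ii' mulr0.
  by rewrite addr0 !mxE !eqxx mulr1.
exists [seq K l | l : 'I_(m * n)].
apply: delta_ext (linearP f) (kraus_map_is_linear _) _ => i j.
by rewrite fE /kraus_map big_map big_enum.
Qed.

Lemma kraus_map_cp (R : realType) m n (s : seq 'M[R[i]]_(n, m)) :
  cp_map (kraus_map s).
Proof. by apply: cp_map_kraus; exists s. Qed.

(** With P = V V^*, each column of [V] gives one Kraus operator: it appends that column as the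
    second tensor factor. *)
Lemma kraus_tensr (R : realType) m n (P : 'M[R[i]]_n) : psd P ->
  kraus (fun X : 'M[R[i]]_m => X *t P).
Proof.
case/psd_factor => V ->.
pose K (l : 'I_n) : 'M[R[i]]_(m * n, m) :=
  \matrix_(x, i) (((mxtens_unindex x).1 == i)%:R * V (mxtens_unindex x).2 l).
apply: (kraus_ext (g := fun X => \sum_l K l *m X *m (K l)^t*)).
  move=> X; apply/matrixP => x y; case: (mxtens_indexP x) => i k.
  case: (mxtens_indexP y) => j k'; rewrite tensmxE summxE mxE mulr_sumr.
  apply: eq_bigr => l _; rewrite [RHS]mxE (bigD1 j) //= big1 => [|j' /negPf jj'].
    rewrite [(K l *m X) _ _]mxE (bigD1 i) //= big1 => [|i' /negPf ii'].
      by rewrite !adjmxE !mxE !mxtens_indexK /= !eqxx !addr0 !mul1r; ring.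
    by rewrite mxE !mxtens_indexK /= eq_sym ii' !mul0r.
  by rewrite adjmxE [K _ _ _]mxE !mxtens_indexK /= eq_sym jj' mul0r
    (rmorph0 (Num.conj : R[i] -> R[i])) mulr0.
by apply: kraus_sum => l; exact: kraus_conj.
Qed.

Lemma kraus_tensl (R : realType) m n (P : 'M[R[i]]_n) : psd P ->
  kraus (fun X : 'M[R[i]]_m => P *t X).
Proof.
case/psd_factor => V ->.
pose K (l : 'I_n) : 'M[R[i]]_(n * m, m) :=
  \matrix_(x, i) (((mxtens_unindex x).2 == i)%:R * V (mxtens_unindex x).1 l).
apply: (kraus_ext (g := fun X => \sum_l K l *m X *m (K l)^t*)).
  move=> X; apply/matrixP => x y; case: (mxtens_indexP x) => k i.
  case: (mxtens_indexP y) => k' j; rewrite tensmxE summxE mxE mulr_suml.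
  apply: eq_bigr => l _; rewrite [RHS]mxE (bigD1 j) //= big1 => [|j' /negPf jj'].
    rewrite [(K l *m X) _ _]mxE (bigD1 i) //= big1 => [|i' /negPf ii'].
      by rewrite !adjmxE !mxE !mxtens_indexK /= !eqxx !addr0 !mul1r; ring.
    by rewrite mxE !mxtens_indexK /= eq_sym ii' !mul0r.
  by rewrite adjmxE [K _ _ _]mxE !mxtens_indexK /= eq_sym jj' mul0r
    (rmorph0 (Num.conj : R[i] -> R[i])) mulr0.
by apply: kraus_sum => l; exact: kraus_conj.
Qed.

Lemma kraus_ptrace1 (R : realType) m n : kraus (@ptrace1 R m n).
Proof.
apply: (kraus_ext (g := fun X => \sum_(k < m)
    mxsub (fun i => mxtens_index (k, i)) (fun i => mxtens_index (k, i)) X)).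
  by move=> X; apply/matrixP => i j; rewrite summxE mxE; apply: eq_bigr => k _; rewrite mxE.
by apply: kraus_sum => k; exact: kraus_mxsub.
Qed.

Lemma kraus_ptrace2 (R : realType) m n : kraus (@ptrace2 R m n).
Proof.
apply: (kraus_ext (g := fun X => \sum_(k < n)
    mxsub (fun i => mxtens_index (i, k)) (fun i => mxtens_index (i, k)) X)).
  by move=> X; apply/matrixP => i j; rewrite summxE mxE; apply: eq_bigr => k _; rewrite mxE.
by apply: kraus_sum => k; exact: kraus_mxsub.
Qed.

(* A positive functional is [X |-> \tr (M X)] with [M] positive. *)
Lemma kraus_functional (R : realType) m n (f : 'M[R[i]]_m -> R[i]^o)
    (P : 'M[R[i]]_n) : linear f -> (forall X, psd X -> 0 <= f X) -> psd P ->
  kraus (fun X => f X *: P).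
Proof.
move=> lf f0 pP; pose M : 'M[R[i]]_m := \matrix_(i, j) f (delta_mx j i).
have fE : f =1 (fun X => \tr (M *m X)).
  apply: delta_ext => // [c A B|i j].
    by rewrite mulmxDr -scalemxAr mxtraceD mxtraceZ.
  by rewrite trM_delta mxE.
have /psd_factor [V VE] : psd M.
  move=> v; have := f0 _ (psd_gram v).
  by rewrite fE mulmxA mxtrace_mulC mulmxA trace_mx11.
(* With M = V V^*, the map conjugates [X] by V^*, appends [P] and traces out the first factor. *)
have := kraus_comp (@kraus_ptrace1 R m n)
  (kraus_comp (kraus_tensr m pP) (kraus_conj (V^t*))).
apply: kraus_ext => X; rewrite ptrace1_tens fE VE trmxCK.
by rewrite -[in LHS]mulmxA [in LHS]mxtrace_mulC.
Qed.

(** * Traces, partial traces and reorderings of tensor factors *)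

Lemma tens_ext3 (R : realType) m n p (V : lmodType R[i])
    (f g : 'M[R[i]]_(m * n * p) -> V) : linear f -> linear g ->
  (forall A B C, f (A *t B *t C) = g (A *t B *t C)) -> f =1 g.
Proof.
move=> lf lg fg; apply: tens_ext => // Y C; move: Y.
apply: tens_ext => [c X Y|c X Y|A B]; last exact: fg.
  by rewrite tensmxDl tensmxZl lf.
by rewrite tensmxDl tensmxZl lg.
Qed.

Lemma linear_mulmx_tr (R : realType) n (M : 'M[R[i]]_n) :
  linear (fun X => \tr (M *m X) : R[i]^o).
Proof. by move=> c X Y; rewrite mulmxDr -scalemxAr mxtraceD mxtraceZ. Qed.

Lemma linear_trM (R : realType) m n (M : 'M[R[i]]_n)
    (f : 'M[R[i]]_m -> 'M[R[i]]_n) : linear f ->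
  linear (fun X => \tr (M *m f X) : R[i]^o).
Proof.
by move=> lf c X Y; rewrite lf mulmxDr -scalemxAr mxtraceD mxtraceZ.
Qed.

Lemma trM_ptrace1 (R : realType) m n (N : 'M[R[i]]_n) (X : 'M[R[i]]_(m * n)) :
  \tr (N *m ptrace1 X) = \tr ((1%:M *t N) *m X).
Proof.
move: X; apply: (@tens_ext R m n R[i]^o) => [||A B].
- exact: (linear_trM _ (@ptrace1_is_linear R m n)).
- exact: linear_mulmx_tr.
- by rewrite ptrace1_tens -scalemxAr mxtraceZ tensmx_mul trace_tens mul1mx.
Qed.

Lemma trM_ptrace2 (R : realType) m n (N : 'M[R[i]]_m) (X : 'M[R[i]]_(m * n)) :
  \tr (N *m ptrace2 X) = \tr ((N *t 1%:M) *m X).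
Proof.
move: X; apply: (@tens_ext R m n R[i]^o) => [||A B].
- exact: (linear_trM _ (@ptrace2_is_linear R m n)).
- exact: linear_mulmx_tr.
- by rewrite ptrace2_tens -scalemxAr mxtraceZ tensmx_mul trace_tens mul1mx mulrC.
Qed.

Lemma tr_ptrace1 (R : realType) m n (X : 'M[R[i]]_(m * n)) : \tr (ptrace1 X) = \tr X.
Proof. by rewrite -[ptrace1 X]mul1mx trM_ptrace1 tensmx11 mul1mx. Qed.

Lemma tr_ptrace2 (R : realType) m n (X : 'M[R[i]]_(m * n)) : \tr (ptrace2 X) = \tr X.
Proof. by rewrite -[ptrace2 X]mul1mx trM_ptrace2 tensmx11 mul1mx. Qed.

Lemma trM_swapmx (R : realType) m n p (A : 'M[R[i]]_m) (B : 'M[R[i]]_n)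
    (C : 'M[R[i]]_p) (X : 'M[R[i]]_(m * n * p)) :
  \tr ((A *t C *t B) *m swapmx X) = \tr ((A *t B *t C) *m X).
Proof.
move: X; apply: (@tens_ext3 R m n p R[i]^o) => [||A' B' C'].
- exact: (linear_trM _ (@swapmx_is_linear R m n p)).
- exact: linear_mulmx_tr.
- by rewrite swapmxE !tensmx_mul !trace_tens mulrAC.
Qed.

Lemma tr_swapmx (R : realType) m n p (X : 'M[R[i]]_(m * n * p)) :
  \tr (swapmx X) = \tr X.
Proof.
by rewrite -[swapmx X]mul1mx -!tensmx11 trM_swapmx !tensmx11 mul1mx.
Qed.

Lemma swapmxK (R : realType) m n p (X : 'M[R[i]]_(m * n * p)) :
  swapmx (swapmx X) = X.
Proof.
move: X; apply: tens_ext3 => [c X Y|//|A B C]; last by rewrite !swapmxE.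
by rewrite !linearP.
Qed.

Lemma ptrace2_swapmx_tens (R : realType) m n p (X : 'M[R[i]]_(m * n))
    (Z : 'M[R[i]]_p) : ptrace2 (swapmx (X *t Z)) = ptrace2 X *t Z.
Proof.
move: X; apply: tens_ext => [c X Y|c X Y|A B].
- by rewrite tensmxDl tensmxZl !linearP.
- by rewrite linearP tensmxDl tensmxZl.
- by rewrite swapmxE !ptrace2_tens tensmxZl.
Qed.

Lemma conj_tens1 (R : realType) m n (K A : 'M[R[i]]_m) (B : 'M[R[i]]_n) :
  (K *t 1%:M) *m (A *t B) *m (K *t 1%:M) = (K *m A *m K) *t B.
Proof. by rewrite !tensmx_mul mul1mx mulmx1. Qed.

Lemma ptrace2_conj (R : realType) m n (P : 'M[R[i]]_m) (X : 'M[R[i]]_(m * n)) :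
  ptrace2 ((P *t 1%:M) *m X *m (P *t 1%:M)) = P *m ptrace2 X *m P.
Proof.
move: X; apply: tens_ext => [c X Y|c X Y|A B].
- by rewrite mulmxDr mulmxDl -scalemxAr -scalemxAl linearP.
- by rewrite linearP mulmxDr mulmxDl -scalemxAr -scalemxAl.
- by rewrite conj_tens1 !ptrace2_tens -scalemxAr -scalemxAl.
Qed.

Lemma ptrace2_tensmap (R : realType) m n p (f : {linear 'M[R[i]]_m -> 'M[R[i]]_n})
    (X : 'M[R[i]]_(m * p)) :
  ptrace2 (tensmap f (@idfun 'M[R[i]]_p) X) = f (ptrace2 X).
Proof.
move: X; apply: tens_ext => [c X Y|c X Y|A B].
- by rewrite !linearP.
- by rewrite !linearP.
- by rewrite tensmapE !ptrace2_tens linearZ.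
Qed.

Lemma ptrace1_tensmap (R : realType) m n p (f : {linear 'M[R[i]]_m -> 'M[R[i]]_n})
    (X : 'M[R[i]]_(p * m)) :
  ptrace1 (tensmap (@idfun 'M[R[i]]_p) f X) = f (ptrace1 X).
Proof.
move: X; apply: tens_ext => [c X Y|c X Y|A B].
- by rewrite !linearP.
- by rewrite !linearP.
- by rewrite tensmapE !ptrace1_tens linearZ.
Qed.

(** No-signalling: a trace-preserving map on the discarded factor is invisible on the other one. *)
Lemma ptrace1_tensmap_tp (R : realType) m n p
    (f : {linear 'M[R[i]]_m -> 'M[R[i]]_n}) (X : 'M[R[i]]_(m * p)) :
  (forall A, \tr (f A) = \tr A) ->
  ptrace1 (tensmap f (@idfun 'M[R[i]]_p) X) = ptrace1 X.
Proof.
move=> tf; move: X; apply: tens_ext => [c X Y|c X Y|A B].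
- by rewrite !linearP.
- by rewrite !linearP.
- by rewrite tensmapE !ptrace1_tens tf.
Qed.

Lemma tr_tensmap2 (R : realType) m n p
    (f : {linear 'M[R[i]]_m -> 'M[R[i]]_n}) (X : 'M[R[i]]_(m * p)) :
  (forall A, \tr (f A) = \tr A) ->
  \tr (tensmap f (@idfun 'M[R[i]]_p) X) = \tr X.
Proof. by move=> tf; rewrite -tr_ptrace1 ptrace1_tensmap_tp // tr_ptrace1. Qed.

Lemma contr_unital (R : realType) m n (g : 'M[R[i]]_m -> 'M[R[i]]_n) N :
  kraus g -> g 1%:M = 1%:M -> contr N -> contr (g N).
Proof.
move=> kg g1 [h1 h2]; have lg := kraus_linear kg.
split; [have := kraus_psd kg h1 | have := kraus_psd kg h2].
  by rewrite addrC -scaleN1r lg g1 scaleN1r addrC.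
by rewrite addrC -[N in N + _]scale1r lg g1 scale1r addrC.
Qed.

Lemma contr_tensl (R : realType) m n (N : 'M[R[i]]_n) :
  contr N -> contr ((1%:M : 'M_m) *t N).
Proof. exact: (contr_unital (kraus_tensl n (@psd1 R m)) (tensmx11 _ _ _)). Qed.

Lemma contr_tensr (R : realType) m n (N : 'M[R[i]]_n) :
  contr N -> contr (N *t (1%:M : 'M_m)).
Proof. exact: (contr_unital (kraus_tensr n (@psd1 R m)) (tensmx11 _ _ _)). Qed.

(** The Heisenberg picture: the adjoint Kraus operators give [g], which is unital because [f]
    preserves the trace. Together with [contr_unital] it stands in for the contractivity of channels
    in trace norm. *)
Lemma kraus_dual (R : realType) m n (f : 'M[R[i]]_m -> 'M[R[i]]_n) :
  kraus f -> (forall X, \tr (f X) = \tr X) ->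
  exists g : 'M[R[i]]_n -> 'M[R[i]]_m, [/\ kraus g, g 1%:M = 1%:M
    & forall N X, \tr (N *m f X) = \tr (g N *m X)].
Proof.
case=> s fs tf; pose g := kraus_map [seq A^t* | A <- s].
have dual N X : \tr (N *m f X) = \tr (g N *m X).
  rewrite fs /g /kraus_map big_map mulmx_sumr mulmx_suml !raddf_sum /=.
  by apply: eq_bigr => A _; rewrite trmxCK !mulmxA mxtrace_mulC !mulmxA.
exists g; split => //; first by exists [seq A^t* | A <- s].
apply/matrixP => i j.
by rewrite -!trM_delta -dual mul1mx tf mul1mx.
Qed.

Lemma trpair_ptrace2 (R : realType) m n (N : 'M[R[i]]_m) (X : 'M[R[i]]_(m * n)) :
  trpair N (ptrace2 X) = trpair (N *t 1%:M) X.
Proof. by rewrite /trpair trM_ptrace2. Qed.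

Lemma trpair_ptrace1 (R : realType) m n (N : 'M[R[i]]_n) (X : 'M[R[i]]_(m * n)) :
  trpair N (ptrace1 X) = trpair (1%:M *t N) X.
Proof. by rewrite /trpair trM_ptrace1. Qed.

Lemma psd_delta (R : realType) n (j : 'I_n) : psd (delta_mx j j : 'M[R[i]]_n).
Proof.
by have := psd_gram (delta_mx j 0 : 'cV[R[i]]_n); rewrite adjmx_delta mul_delta_mx.
Qed.

Lemma psd_id_sub_delta (R : realType) n (j : 'I_n) :
  psd (1%:M - delta_mx j j : 'M[R[i]]_n).
Proof.
rewrite mx1_sum_delta (bigD1 j) //= addrAC subrr add0r.
apply: big_ind => [||k _]; [exact: psd0 | by move=> X Y; exact: psdD |].
exact: psd_delta.
Qed.

Lemma contr_psd (R : realType) n (N : 'M[R[i]]_n) :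
  psd N -> psd (1%:M - N) -> contr N.
Proof. by move=> h1 h2; split=> //; apply: psdD => //; exact: psd1. Qed.

(** * The accept and reject projectors, and the key state *)

Lemma accmx_is_linear (R : realType) a : linear (@accmx R a).
Proof.
move=> c X Y; rewrite /accmx scale_block_mx add_block_mx.
by rewrite !scaler0 !addr0.
Qed.
HB.instance Definition _ (R : realType) a :=
  GRing.isLinear.Build R[i] 'M[R[i]]_a 'M[R[i]]_(a + 1) _ (@accmx R a)
    (@accmx_is_linear R a).

Lemma tr_accmx (R : realType) a (X : 'M[R[i]]_a) : \tr (accmx X) = \tr X.
Proof. by rewrite mxtrace_block mxtrace0 addr0. Qed.

Lemma kraus_accmx (R : realType) a : kraus (@accmx R a).
Proof.
apply: kraus_ext (kraus_conj (col_mx 1%:M 0)) => X.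
rewrite tr_col_mx map_row_mx -/(_^t*) adjmx1 trmx0 map_mx0.
by rewrite mul_col_mx mul_col_row !mul0mx !mulmx0 mul1mx mulmx1.
Qed.

Lemma PaccE (R : realType) a : Pacc R a = 1%:M - Pbot R a.
Proof.
rewrite /Pacc /Pbot (scalar_mx_block a 1) opp_block_mx add_block_mx.
by rewrite !oppr0 !addr0 subrr.
Qed.

Lemma Pbot_idem (R : realType) a : Pbot R a *m Pbot R a = Pbot R a.
Proof. by rewrite mulmx_block !mul0mx !mulmx0 !addr0 add0r mulmx1. Qed.

Lemma Pacc_idem (R : realType) a : Pacc R a *m Pacc R a = Pacc R a.
Proof. by rewrite mulmx_block !mul0mx !mulmx0 !addr0 mulmx1. Qed.

Lemma Pbot_adj (R : realType) a : (Pbot R a)^t* = Pbot R a.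
Proof.
by rewrite /Pbot tr_block_mx map_block_mx !trmx0 !map_mx0 trmx1 map_mx1.
Qed.

Lemma Pacc_adj (R : realType) a : (Pacc R a)^t* = Pacc R a.
Proof. by rewrite PaccE adjmxD adjmxN adjmx1 Pbot_adj. Qed.

Lemma psd_Pbot (R : realType) a : psd (Pbot R a).
Proof. by have := psd_gram (Pbot R a); rewrite Pbot_adj Pbot_idem. Qed.

Lemma psd_Pacc (R : realType) a : psd (Pacc R a).
Proof. by have := psd_gram (Pacc R a); rewrite Pacc_adj Pacc_idem. Qed.

Lemma contr_Pbot (R : realType) a : contr (Pbot R a).
Proof. by apply: contr_psd; rewrite -?PaccE; [exact: psd_Pbot | exact: psd_Pacc]. Qed.

Lemma psd_tauK (R : realType) (S : qes R) : psd (tauK S).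
Proof.
apply: psdZ; first by rewrite invr_ge0 ler0n.
by apply: psd_sum => k; exact: psd_delta.
Qed.

Lemma tr_tauK (R : realType) (S : qes R) : \tr (tauK S) = 1.
Proof.
rewrite mxtraceZ -mx1_sum_delta mxtrace1 mulVf //.
by rewrite pnatr_eq0 -lt0n dimK_gt0.
Qed.

(** * Encryption, attack and decryption *)

(** This is the first stage of [attacked]. Its [ptrace2] discards the key and leaves the
    key-averaged ciphertext together with B. *)
Definition encrypted (R : realType) (S : qes R) (b : nat)
    (rho : 'M[R[i]]_(dimA S * b)%N) : 'M[R[i]]_(dimC S * b * dimK S)%N :=
  swapmx (tensmap (enc S) (@idfun 'M_b) (swapmx (rho *t tauK S))).

Lemma attackedE (R : realType) (S : qes R) b bt
    (L : 'M[R[i]]_(dimC S * b)%N -> 'M[R[i]]_(dimC S * bt)%N) rho :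
  attacked L rho = swapmx (tensmap (dec S) (@idfun 'M_bt)
    (swapmx (tensmap L (@idfun 'M_(dimK S)) (encrypted rho)))).
Proof. by []. Qed.

Lemma kraus_encrypted (R : realType) (S : qes R) b :
  kraus (@encrypted R S b).
Proof.
exact: (kraus_comp (kraus_swapmx _ _ _ _)
  (kraus_comp (kraus_tensmap2 _ (kraus_cp_map (enc_channel S).1))
    (kraus_comp (kraus_swapmx _ _ _ _) (kraus_tensr _ (@psd_tauK R S))))).
Qed.

Lemma tr_encrypted (R : realType) (S : qes R) b
    (rho : 'M[R[i]]_(dimA S * b)%N) : \tr (encrypted rho) = \tr rho.
Proof.
rewrite tr_swapmx tr_tensmap2 ?tr_swapmx ?trace_tens ?tr_tauK ?mulr1 //.
exact: (enc_channel S).2.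
Qed.

Lemma kraus_attacked (R : realType) (S : qes R) b bt
    (L : {linear 'M[R[i]]_(dimC S * b)%N -> 'M[R[i]]_(dimC S * bt)%N}) :
  channel L -> kraus (attacked L).
Proof.
move=> [/kraus_cp_map kL _].
exact: (kraus_comp (kraus_swapmx _ _ _ _)
  (kraus_comp (kraus_tensmap2 _ (kraus_cp_map (dec_channel S).1))
    (kraus_comp (kraus_swapmx _ _ _ _)
      (kraus_comp (kraus_tensmap2 _ kL) (kraus_encrypted S b))))).
Qed.

(** Decryption does not touch the side information, so the effect [N] there may be evaluated before
    decrypting. *)
Lemma trM_dec (R : realType) (S : qes R) bt (M : 'M[R[i]]_(dimA S + 1))
    (N : 'M[R[i]]_bt) (Z : 'M[R[i]]_(dimC S * dimK S * bt)) :
  \tr ((M *t N *t 1%:M) *m swapmx (tensmap (dec S) (@idfun 'M_bt) Z))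
  = \tr ((M *t 1%:M) *m dec S (ptrace2 ((1%:M *t N) *m Z))).
Proof.
rewrite trM_swapmx; move: Z.
apply: (@tens_ext R _ _ R[i]^o) => [||A B].
- exact: (linear_trM _ (tensmap_is_linear _ _)).
- apply: (@linear_trM R _ _ _ (fun Z => dec S (ptrace2 ((1%:M *t N) *m Z)))).
  by move=> c X Y; rewrite mulmxDr -scalemxAr !linearP.
- rewrite tensmapE !tensmx_mul mul1mx ptrace2_tens linearZ /= trace_tens.
  by rewrite -scalemxAr mxtraceZ mulrC.
Qed.

(** When the message register and the key are both discarded, decryption only preserves the trace,
    and the attack sees the ciphertext averaged over the key. *)
Lemma trM_attacked (R : realType) (S : qes R) b bt
    (L : {linear 'M[R[i]]_(dimC S * b)%N -> 'M[R[i]]_(dimC S * bt)%N})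
    (N : 'M[R[i]]_bt) rho :
  \tr ((1%:M *t N *t 1%:M) *m attacked L rho)
  = \tr ((1%:M *t N) *m L (ptrace2 (encrypted rho))).
Proof.
rewrite attackedE trM_dec tensmx11 mul1mx (dec_channel S).2 tr_ptrace2.
by rewrite -tensmx11 trM_swapmx -trM_ptrace2 ptrace2_tensmap.
Qed.

Lemma dec_enc_tau (R : realType) (S : qes R) (X : 'M[R[i]]_(dimA S)) :
  dec S (enc S (X *t tauK S)) = accmx X *t tauK S.
Proof.
rewrite /tauK !tensmxZr !linearZ /= !tensmx_sumr !linear_sum /=.
by apply: eq_bigr => k _; rewrite dec_enc.
Qed.

(** The weight of rejection when the possibly unnormalized [Y] is decrypted and its side information
    is discarded. *)
Definition rejpr (R : realType) (S : qes R) b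
    (Y : 'M[R[i]]_(dimC S * b * dimK S)) : R :=
  trpair (Pbot R (dimA S) *t 1%:M) (dec S (ptrace2 (swapmx Y))).

Lemma rejpr_linear (R : realType) (S : qes R) b (t : R)
    (X Y : 'M[R[i]]_(dimC S * b * dimK S)) :
  rejpr (X + t%:C *: Y) = rejpr X + t * rejpr Y.
Proof. by rewrite /rejpr addrC !linearP trpairDr trpairZr addrC. Qed.

Lemma rejpr_ge0 (R : realType) (S : qes R) b
    (Y : 'M[R[i]]_(dimC S * b * dimK S)) : psd Y -> 0 <= rejpr Y.
Proof.
move=> pY; apply: trpair_psd_ge0.
  exact: (kraus_psd (kraus_tensr _ (@psd1 R (dimK S))) (@psd_Pbot R (dimA S))).
apply: (kraus_psd (kraus_cp_map (dec_channel S).1)).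
by apply: (kraus_psd (kraus_ptrace2 _ _ _)); apply: (kraus_psd (kraus_swapmx _ _ _ _)).
Qed.

Lemma rejpr_le (R : realType) (S : qes R) b
    (Y : 'M[R[i]]_(dimC S * b * dimK S)) :
  psd Y -> rejpr Y <= complex.Re (\tr Y).
Proof.
move=> pY; rewrite -[in leRHS]tr_swapmx -tr_ptrace2 -(dec_channel S).2.
apply: trpair_contr_psd; first exact/contr_tensr/contr_Pbot.
apply: (kraus_psd (kraus_cp_map (dec_channel S).1)).
by apply: (kraus_psd (kraus_ptrace2 _ _ _)); apply: (kraus_psd (kraus_swapmx _ _ _ _)).
Qed.

(** Correctness of the scheme: decrypting an untouched ciphertext gives an operator supported on the
    message block, orthogonal to the reject symbol. *)
Lemma rejpr_encrypted (R : realType) (S : qes R) b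
    (rho : 'M[R[i]]_(dimA S * b)) : rejpr (encrypted rho) = 0.
Proof.
rewrite /rejpr /encrypted swapmxK ptrace2_tensmap ptrace2_swapmx_tens dec_enc_tau.
rewrite /trpair tensmx_mul /Pbot /accmx mulmx_block !mul0mx !mulmx0 !addr0.
by rewrite block_mx0 tens0mx mxtrace0.
Qed.

Lemma quadratic_ge0_linear0 (R : realType) (l m : R) :
  0 <= m -> (forall t, 0 <= t * l + t ^+ 2 * m) -> l = 0.
Proof.
(* At this t the polynomial equals minus the square of l / (m + 1); the added 1 keeps the
   denominator nonzero when m = 0. *)
move=> m0 /(_ (- (l / (m + 1)))) h; have m1 : m + 1 != 0 by lra.
have e : - (l / (m + 1)) * l + (- (l / (m + 1))) ^+ 2 * m = - (l / (m + 1)) ^+ 2.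
  by field.
move: h; rewrite e oppr_ge0 => h.
have /eqP : (l / (m + 1)) ^+ 2 = 0 by apply/le_anti; rewrite h sqr_ge0.
rewrite sqrf_eq0 mulf_eq0 invr_eq0 (negPf m1) orbF => /eqP //.
Qed.

(* The reject probability vanishes at [t = 0], where it is minimal, so that it
   has no linear term in [t]. *)
Lemma rejpr_disturb (R : realType) (S : qes R) b
    (W : 'M[R[i]]_(dimC S * b * dimK S)) rho (t : R) : W^t* = W ->
  let e := encrypted rho in psd e ->
  rejpr ((1%:M + t%:C *: W) *m e *m (1%:M + t%:C *: W)) = t ^+ 2 * rejpr (W *m e *m W).
Proof.
move=> hW e pe.
have expand s : rejpr ((1%:M + s%:C *: W) *m e *m (1%:M + s%:C *: W))
    = s * rejpr (W *m e + e *m W) + s ^+ 2 * rejpr (W *m e *m W).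
  rewrite -[RHS]add0r -{1}(rejpr_encrypted rho) -/e addrA -!rejpr_linear.
  congr rejpr; rewrite !(mulmxDl, mulmxDr) !mulmx1 !mul1mx.
  rewrite -!scalemxAl -!scalemxAr scalerA -rmorphM -expr2 !scalerDr.
  by rewrite !addrA.
have hK s : (1%:M + s%:C *: W)^t* = 1%:M + s%:C *: W.
  by rewrite adjmxD adjmx1 adjmxZ conj_real_complex hW.
have pW : psd (W *m e *m W) by have := psd_conj W pe; rewrite hW.
rewrite expand; suff -> : rejpr (W *m e + e *m W) = 0 by rewrite mulr0 add0r.
apply: (quadratic_ge0_linear0 (rejpr_ge0 pW)) => s.
rewrite -expand; apply: rejpr_ge0.
by have := psd_conj (1%:M + s%:C *: W) pe; rewrite hK.
Qed.

(** The simulated accepted branch, seen from the side information alone, depends on [rho] only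
    through its marginal on B. *)
Lemma trM_accepted (R : realType) a b bt
    (F : {linear 'M[R[i]]_b -> 'M[R[i]]_bt}) (N : 'M[R[i]]_bt)
    (rho : 'M[R[i]]_(a * b)) :
  \tr ((1%:M *t N) *m accepted F rho) = \tr (N *m F (ptrace1 rho)).
Proof.
by rewrite -trM_ptrace1 ptrace1_tensmap_tp ?ptrace1_tensmap //; exact: tr_accmx.
Qed.

Lemma kraus_accepted (R : realType) a b bt
    (F : {linear 'M[R[i]]_b -> 'M[R[i]]_bt}) :
  cp_map F -> kraus (@accepted R a b bt F).
Proof.
move=> cF; apply: (kraus_comp (kraus_tensmap2 _ (@kraus_accmx R a))).
exact: (kraus_tensmap1 _ (kraus_cp_map cF)).
Qed.

(** The inner clause of [GYZ_authenticating], for one attack and one given simulator. *)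
Definition accept_simulated (R : realType) (S : qes R) (eps : R) b bt
    (L : {linear 'M[R[i]]_(dimC S * b)%N -> 'M[R[i]]_(dimC S * bt)%N})
    (F : {linear 'M[R[i]]_b -> 'M[R[i]]_bt}) : Prop :=
  forall rho : 'M[R[i]]_(dimA S * b)%N, state rho ->
      let P := Pacc R (dimA S) *t (1%:M : 'M_bt) *t (1%:M : 'M_(dimK S)) in
      trnorm (P *m attacked L rho *m P - accepted F rho *t tauK S) <= eps.

(** The key is discarded by testing with [N] tensored with the identity, which is again an
    admissible test for the trace norm bound. *)
Lemma accept_pair_le (R : realType) (S : qes R) (eps : R) b bt
    (L : {linear 'M[R[i]]_(dimC S * b)%N -> 'M[R[i]]_(dimC S * bt)%N})
    (F : {linear 'M[R[i]]_b -> 'M[R[i]]_bt}) rho (N : 'M[R[i]]_((dimA S + 1) * bt)) :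
  channel L -> cp_map F -> state rho -> accept_simulated eps L F -> contr N ->
  trpair N ((Pacc R (dimA S) *t 1%:M) *m ptrace2 (attacked L rho)
          *m (Pacc R (dimA S) *t 1%:M) - accepted F rho) <= eps.
Proof.
move=> cL cF srho GF cN; set P := Pacc R (dimA S) *t 1%:M; apply: le_trans _ (GF _ srho).
set G := attacked L rho; set Q := Pacc _ _ *t _ *t _.
have pG : psd G by apply: (kraus_psd (kraus_attacked cL)); case: srho.
have pA : psd (accepted F rho *t tauK S).
  apply: (kraus_psd (kraus_tensr _ (@psd_tauK R S))).
  exact: (kraus_psd (@kraus_accepted R (dimA S) _ _ F cF) srho.1).
have hQ : Q^t* = Q by rewrite !adjmx_tens Pacc_adj !adjmx1.
have -> : P *m ptrace2 G *m P - accepted F rho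
    = ptrace2 (Q *m G *m Q - accepted F rho *t tauK S).
  rewrite linearB /= ptrace2_tens tr_tauK scale1r; congr (_ - _).
  by rewrite /Q ptrace2_conj.
rewrite trpair_ptrace2; apply: trpair_le_trnorm; last exact: contr_tensr.
by rewrite adjmxD adjmxN (psd_herm pA) !adjmxM hQ (psd_herm pG) mulmxA.
Qed.

(** * Secrecy from a weak measurement *)

Lemma trpair_conj (R : realType) n (N P X : 'M[R[i]]_n) :
  trpair N (P *m X *m P) = trpair (P *m N *m P) X.
Proof. by rewrite /trpair !mulmxA mxtrace_mulC !mulmxA. Qed.

(** Both signs of [N], tensored with the identity on the message, serve as tests. Hence the accepted
    statistics of the side information are fixed by the marginal of [rho] on B, up to [eps]. *)
Lemma accept_marginal (R : realType) (S : qes R) (eps : R) b bt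
    (L : {linear 'M[R[i]]_(dimC S * b)%N -> 'M[R[i]]_(dimC S * bt)%N})
    (F : {linear 'M[R[i]]_b -> 'M[R[i]]_bt}) rho (N : 'M[R[i]]_bt) :
  channel L -> cp_map F -> state rho -> accept_simulated eps L F -> contr N ->
  `|trpair (Pacc R (dimA S) *t N *t 1%:M) (attacked L rho) - trpair N (F (ptrace1 rho))|
     <= eps.
Proof.
move=> cL cF srho GF cN.
have le M : contr M ->
    trpair (Pacc R (dimA S) *t M *t 1%:M) (attacked L rho) - trpair M (F (ptrace1 rho))
    <= eps.
  move=> cM; have := accept_pair_le cL cF srho GF (contr_tensl (dimA S + 1) cM).
  rewrite trpairDr trpairNr trpair_conj !tensmx_mul !mulmx1 mul1mx Pacc_idem.
  by rewrite trpair_ptrace2 {2}/trpair trM_accepted.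
have := le _ (contrN cN); have := le _ cN.
rewrite -[- N]scaleN1r tensmxZr tensmxZl !scaleN1r !trpairNl => h1 h2.
by rewrite ler_norml; lra.
Qed.

Lemma tr_delta (R : realType) n (s : 'I_n) :
  \tr (delta_mx s s : 'M[R[i]]_n) = 1.
Proof. by rewrite -[delta_mx s s]mul1mx trM_delta mxE eqxx. Qed.

Definition weak_kraus (R : realType) n (h : R) (W : 'M[R[i]]_n) (s : 'I_2) :=
  1%:M + ((-1) ^+ s * h)%:C *: W.

(* The two-outcome instrument with Kraus operators proportional to [1 + h W]
   and [1 - h W], the outcome being the new side information. *)
Definition weak_meas (R : realType) c b (h : R) (W : 'M[R[i]]_(c * b))
    (X : 'M[R[i]]_(c * b)) : 'M[R[i]]_(c * 2) :=
  ((2 * (1 + h ^+ 2))^-1)%:C *: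
    \sum_(s < 2) ptrace2 (weak_kraus h W s *m X *m weak_kraus h W s) *t delta_mx s s.

Lemma weak_kraus_adj (R : realType) n (h : R) (W : 'M[R[i]]_n) s :
  W^t* = W -> (weak_kraus h W s)^t* = weak_kraus h W s.
Proof. by move=> hW; rewrite adjmxD adjmx1 adjmxZ conj_real_complex hW. Qed.

(** As [W] squares to 1, only the terms 1 + h^2 and 2 h W with the sign of the outcome remain. The
    latter cancel between the two outcomes, whence the normalization 2 (1 + h^2) in [weak_meas]. *)
Lemma weak_kraus_sq (R : realType) n (h : R) (W : 'M[R[i]]_n) (s : 'I_2) :
  W *m W = 1%:M -> weak_kraus h W s *m weak_kraus h W s
  = (1 + h ^+ 2)%:C *: 1%:M + (2 * ((-1) ^+ s * h))%:C *: W.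
Proof.
move=> WW; rewrite /weak_kraus; set t := (-1) ^+ s * h.
have -> : h ^+ 2 = t * t by rewrite -expr2 exprMn sqrr_sign mul1r.
rewrite !(mulmxDl, mulmxDr) !mulmx1 mul1mx -scalemxAl -scalemxAr WW scalerA.
rewrite -rmorphM mulr_natl mulr2n !rmorphD /= rmorph1 !scalerDl scale1r.

rewrite -!addrA; congr (_ + _); by rewrite addrA addrC.
Qed.

Lemma tr_weak_kraus (R : realType) n (h : R) (W : 'M[R[i]]_n) (s : 'I_2) X :
  W *m W = 1%:M -> complex.Re (\tr (weak_kraus h W s *m X *m weak_kraus h W s))
  = (1 + h ^+ 2) * complex.Re (\tr X) + 2 * ((-1) ^+ s * h) * trpair W X.
Proof.
move=> WW; rewrite mxtrace_mulC mulmxA weak_kraus_sq // -/(trpair _ X).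
by rewrite trpairDl !trpairZl trpair1.
Qed.

Lemma weak_meas_kraus (R : realType) c b (h : R) (W : 'M[R[i]]_(c * b)) :
  W^t* = W -> kraus (weak_meas h W).
Proof.
move=> hW; apply: kraus_scale; first by rewrite ler0c invr_ge0; have := sqr_ge0 h; lra.
apply: kraus_sum => s; have := kraus_comp (kraus_tensr c (@psd_delta R _ s))
  (kraus_comp (kraus_ptrace2 R c b) (kraus_conj (weak_kraus h W s))).
by rewrite weak_kraus_adj.
Qed.

Lemma weak_meas_tp (R : realType) c b (h : R) (W : 'M[R[i]]_(c * b)) X :
  W *m W = 1%:M -> \tr (weak_meas h W X) = \tr X.
Proof.
move=> WW; rewrite mxtraceZ raddf_sum /=.
under eq_bigr => s _.
  rewrite trace_tens (tr_delta R s) mulr1 tr_ptrace2 mxtrace_mulC mulmxA; over.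
rewrite big_ord_recl big_ord1.
rewrite -mxtraceD -mulmxDl !weak_kraus_sq //= expr0 expr1 mul1r mulN1r mulrN rmorphN /=.
rewrite addrACA scaleNr subrr addr0 -scalerDl -rmorphD /= -scalemxAl mul1mx mxtraceZ.
rewrite mulrA -rmorphM /= (_ : (2 * (1 + h ^+ 2))^-1 * _ = 1) ?mul1r //.
by field; have := sqr_ge0 h; lra.
Qed.

(** The unnormalized operator on the outer two factors, given the effect [N] on the middle one. *)
Definition postselect (R : realType) m n p (N : 'M[R[i]]_n)
    (X : 'M[R[i]]_(m * n * p)) : 'M[R[i]]_(m * p) :=
  ptrace2 ((1%:M *t N) *m swapmx X).

Lemma postselect_is_linear (R : realType) m n p (N : 'M[R[i]]_n) :
  linear (@postselect R m n p N).
Proof. by move=> c X Y; rewrite /postselect linearP mulmxDr -scalemxAr linearP. Qed.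
HB.instance Definition _ (R : realType) m n p (N : 'M[R[i]]_n) :=
  GRing.isLinear.Build R[i] 'M[R[i]]_(m * n * p) 'M[R[i]]_(m * p) _
    (@postselect R m n p N) (@postselect_is_linear R m n p N).

Lemma postselect_tens (R : realType) m n p (A : 'M[R[i]]_m) (B N : 'M[R[i]]_n)
    (C : 'M[R[i]]_p) :
  postselect N (A *t B *t C) = \tr (N *m B) *: (A *t C).
Proof. by rewrite /postselect swapmxE tensmx_mul mul1mx ptrace2_tens. Qed.

Lemma postselect_weak_meas (R : realType) c b k (h : R) (W : 'M[R[i]]_(c * b))
    (A : 'M[R[i]]_(c * b)) (B : 'M[R[i]]_k) :
  postselect (delta_mx 0 0) (weak_meas h W A *t B)
  = ((2 * (1 + h ^+ 2))^-1)%:C *: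
      (ptrace2 (weak_kraus h W 0 *m A *m weak_kraus h W 0) *t B).
Proof.
rewrite /weak_meas tensmxZl linearZ /=; congr (_ *: _).
rewrite tensmx_suml linear_sum big_ord_recl big_ord1 /=.
rewrite postselect_tens mul_delta_mx (tr_delta R ord0) scale1r.
by rewrite postselect_tens mul_delta_mx_0 // mxtrace0 scale0r addr0.
Qed.

Lemma postselect_attack (R : realType) c b k (h : R) (W : 'M[R[i]]_(c * b))
    (L : {linear 'M[R[i]]_(c * b)%N -> 'M[R[i]]_(c * 2)%N}) :
  L =1 weak_meas h W -> forall e : 'M[R[i]]_(c * b * k),
  postselect (delta_mx 0 0) (tensmap L (@idfun 'M_k) e)
  = ((2 * (1 + h ^+ 2))^-1)%:C *:
    ptrace2 (swapmx ((weak_kraus h W 0 *t 1%:M) *m e *m (weak_kraus h W 0 *t 1%:M))).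
Proof.
move=> LW; set K := weak_kraus h W 0; set t := _%:C; apply: tens_ext => [||A B].
- by move=> x X Y; rewrite linearP linearP.
- move=> x X Y; rewrite mulmxDr mulmxDl -scalemxAr -scalemxAl linearP linearP.
  by rewrite scalerDr !scalerA mulrC.
- by rewrite tensmapE LW postselect_weak_meas conj_tens1 ptrace2_swapmx_tens.
Qed.

(** Outcome 0 conjugates the encrypted state by 1 + h W, the key untouched, which brings the joint
    weight of this outcome and rejection to the form of [rejpr_disturb]. *)
Lemma weak_meas_reject (R : realType) (S : qes R) b (h : R)
    (W : 'M[R[i]]_(dimC S * b))
    (L : {linear 'M[R[i]]_(dimC S * b)%N -> 'M[R[i]]_(dimC S * 2)%N}) rho :
  L =1 weak_meas h W ->
  trpair (Pbot R (dimA S) *t delta_mx 0 0 *t 1%:M) (attacked L rho)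
  = (2 * (1 + h ^+ 2))^-1 * rejpr ((1%:M + h%:C *: (W *t 1%:M)) *m encrypted rho
       *m (1%:M + h%:C *: (W *t 1%:M))).
Proof.
move=> LW; rewrite {1}/trpair attackedE trM_dec -/(postselect _ _).
rewrite (postselect_attack LW) linearZ /= -/(trpair _ _) trpairZr /rejpr.
by rewrite /weak_kraus expr0 mul1r tensmxDl tensmx11 tensmxZl.
Qed.

Lemma trpair_weak_meas (R : realType) c b (h : R) (W : 'M[R[i]]_(c * b)) X :
  W *m W = 1%:M ->
  trpair (1%:M *t delta_mx 0 0) (weak_meas h W X)
  = (2 * (1 + h ^+ 2))^-1 * ((1 + h ^+ 2) * complex.Re (\tr X) + 2 * h * trpair W X).
Proof.
move=> WW; rewrite trpairZr; congr (_ * _).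
have flag (Q : 'M[R[i]]_c) (s : 'I_2) :
    \tr ((1%:M *t delta_mx 0 0) *m (Q *t delta_mx s s)) = \tr Q *+ (0 == s).
  rewrite tensmx_mul mul1mx trace_tens mul_delta_mx_cond linearMn /=.
  have [<-|_] := eqVneq; last by rewrite mulr0.
  by rewrite (tr_delta R ord0) mulr1.
rewrite big_ord_recl big_ord1 trpairDr {1 2}/trpair !flag /= mulr1n addr0 tr_ptrace2.
by rewrite (tr_weak_kraus h ord0 X WW) expr0 mul1r.
Qed.

(** Both estimates have the same target [f], so they differ by at most 2 h^2. Multiplying by 2 (1 +
    h^2) <= 4 gives 2 h (w - w') <= 8 h^2 + h^2 (m - m') <= 9 h^2, and division by 2 h gives the
    constant 9/2. *)
Lemma weak_meas_arith (R : realFieldType) (h c f m m' w w' : R) :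
    0 < h <= 1 -> c * (2 * (1 + h ^+ 2)) = 1 -> 0 <= m <= 1 -> 0 <= m' <= 1 ->
    `|c * (1 + h ^+ 2 + 2 * h * w - h ^+ 2 * m) - f| <= h ^+ 2 ->
    `|c * (1 + h ^+ 2 + 2 * h * w' - h ^+ 2 * m') - f| <= h ^+ 2 ->
  w - w' <= 9%:R / 2%:R * h.
Proof.
move=> /andP[h0 h1] cE /andP[m0 m1] /andP[m0' m1'].
rewrite !ler_norml => /andP[_ l] /andP[l' _].
have h20 : 0 <= h ^+ 2 by exact: sqr_ge0.
have h21 : h ^+ 2 <= 1 by rewrite expr_le1 // ltW.
have u0 : 0 <= 2 * (1 + h ^+ 2) by lra.
have : (2 * (1 + h ^+ 2)) * (c * (2 * h * (w - w') - h ^+ 2 * (m - m')))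
    <= (2 * (1 + h ^+ 2)) * (2 * h ^+ 2) by apply: ler_wpM2l => //; lra.
rewrite mulrA [_ * c]mulrC cE mul1r => le1.
have le2 : (2 * (1 + h ^+ 2)) * (2 * h ^+ 2) <= 8%:R * h ^+ 2.
  by rewrite mulrA ler_wpM2r //; lra.
have le3 : h ^+ 2 * (m - m') <= h ^+ 2 by rewrite ler_piMr //; lra.
have le4 : (2 * h) * (w - w') <= (2 * h) * (9%:R / 2%:R * h).
  have -> : (2 * h) * (9%:R / 2%:R * h) = 9%:R * h ^+ 2 by field.
  lra.
by rewrite ler_pM2l // in le4; lra.
Qed.

Lemma secrecy (R : realType) (S : qes R) (eps : R) b
    (rho rho' : 'M[R[i]]_(dimA S * b)) :
  GYZ_authenticating eps S -> 0 < eps <= 1 -> state rho -> state rho' ->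
  ptrace1 rho = ptrace1 rho' ->
  trnorm (ptrace2 (encrypted rho) - ptrace2 (encrypted rho'))
    <= 9%:R / 2%:R * Num.sqrt eps.
Proof.
move=> GYZ /andP[e0 e1] srho srho' eqB.
have psdE (r : 'M_(dimA S * b)) : state r -> psd (encrypted r).
  by move=> [+ _]; exact: (kraus_psd (kraus_encrypted S b)).
have psdEb (r : 'M_(dimA S * b)) : state r -> psd (ptrace2 (encrypted r)).
  by move=> /psdE; exact: (kraus_psd (kraus_ptrace2 _ _ _)).
(* [W] is the sign of the difference: the Hermitian unitary that distinguishes the two ciphertexts
   best is the one measured weakly. *)
have /trnorm_attained [W [hW WW ->]] :
    (ptrace2 (encrypted rho) - ptrace2 (encrypted rho'))^t*
    = ptrace2 (encrypted rho) - ptrace2 (encrypted rho').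
  by rewrite adjmxD adjmxN !(psd_herm (psdEb _ _)).
rewrite trpairDr trpairNr.
suff main h : 0 < h <= 1 -> h ^+ 2 = eps ->
    trpair W (ptrace2 (encrypted rho)) - trpair W (ptrace2 (encrypted rho'))
      <= 9%:R / 2%:R * h.
  apply: main; last by rewrite sqr_sqrtr // ltW.
  by rewrite sqrtr_gt0 e0 -sqrtr1 ler_wsqrtr.
move=> h01 hh.
pose L : {linear _ -> _} := HB.pack (weak_meas h W)
  (GRing.isLinear.Build _ _ _ _ (weak_meas h W)
    (kraus_linear (weak_meas_kraus h hW))).
have cL : channel L.
  split; first exact: (cp_map_kraus (f := L) (weak_meas_kraus h hW)).
  by move=> X; exact: weak_meas_tp.
have [F [cF GF]] := GYZ _ _ L cL.
pose d : 'M[R[i]]_2 := delta_mx 0 0.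
have cd : contr d by apply: contr_psd; [exact: psd_delta | exact: psd_id_sub_delta].
pose c := (2 * (1 + h ^+ 2))^-1.
have cE : c * (2 * (1 + h ^+ 2)) = 1 by apply: mulVf; have := sqr_ge0 h; lra.
(* For each input, the weight of outcome 0 with acceptance is the total weight of outcome 0 minus
   its rejected part; [m] is the reject weight after applying [W] in full, at most 1. *)
have key (r : 'M_(dimA S * b)) : state r -> exists2 m : R, 0 <= m <= 1 &
    `|c * (1 + h ^+ 2 + 2 * h * trpair W (ptrace2 (encrypted r)) - h ^+ 2 * m)
      - trpair d (F (ptrace1 r))| <= h ^+ 2.
  move=> sr; pose W' := W *t (1%:M : 'M_(dimK S)); pose m := rejpr (W' *m encrypted r *m W').
  have hW' : W'^t* = W' by rewrite adjmx_tens adjmx1 hW.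
  have WW' : W' *m W' = 1%:M by rewrite tensmx_mul WW mulmx1 tensmx11.
  have tr1 : complex.Re (\tr (encrypted r)) = 1 by rewrite tr_encrypted sr.2.
  have pm : psd (W' *m encrypted r *m W').
    by have := psd_conj W' (psdE _ sr); rewrite hW'.
  exists m.
    apply/andP; split; first exact: rejpr_ge0.
    by apply: le_trans (rejpr_le pm) _; rewrite mxtrace_mulC mulmxA WW' mul1mx tr1.
  rewrite [leRHS]hh; apply: le_trans (accept_marginal cL cF sr GF cd).
  suff -> : trpair (Pacc R (dimA S) *t d *t 1%:M) (attacked L r)
    = c * (1 + h ^+ 2 + 2 * h * trpair W (ptrace2 (encrypted r)) - h ^+ 2 * m) by [].
  have -> : Pacc R (dimA S) *t d *t 1%:M
      = 1%:M *t d *t (1%:M : 'M_(dimK S)) - Pbot R (dimA S) *t d *t 1%:M.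
    by rewrite PaccE -scaleN1r !(tensmxDl, tensmxZl) scaleN1r.
  rewrite trpairDl trpairNl (@weak_meas_reject _ _ _ h W) //.
  rewrite (rejpr_disturb h hW' (psdE _ sr)) -/W' -/m -/c.
  suff -> : trpair (1%:M *t d *t 1%:M) (attacked L r)
      = c * (1 + h ^+ 2 + 2 * h * trpair W (ptrace2 (encrypted r))) by ring.
  rewrite {1}/trpair trM_attacked -/(trpair _ _).
  by rewrite trpair_weak_meas // tr_ptrace2 tr1 mulr1.
have [m m01 h1] := key _ srho; have [m' m01' h2] := key _ srho'.
rewrite -eqB in h2; exact: (weak_meas_arith h01 cE m01 m01' h1 h2).
Qed.

(** * The simulator of the reject branch *)

Lemma linear_conj2 (R : realType) m n (P Q : 'M[R[i]]_n)
    (f : 'M[R[i]]_m -> 'M[R[i]]_n) :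
  linear f -> linear (fun X => P *m f X *m P + Q *m f X *m Q).
Proof.
move=> lf c X Y; rewrite lf !mulmxDr !mulmxDl -!scalemxAr -!scalemxAl.
by rewrite scalerDr addrACA.
Qed.

(** The block structure of [dec], which includes the measurement of the reject symbol, survives
    adjoining side information and discarding the key. *)
Lemma marginal_block (R : realType) (S : qes R) bt
    (Z : 'M[R[i]]_(dimC S * dimK S * bt)) :
  let M := ptrace2 (swapmx (tensmap (dec S) (@idfun 'M_bt) Z)) in
  let P := Pacc R (dimA S) *t 1%:M in let Q := Pbot R (dimA S) *t 1%:M in
  M = P *m M *m P + Q *m M *m Q.
Proof.
have lM : linear (fun Z : 'M[R[i]]_(dimC S * dimK S * bt) =>
    ptrace2 (swapmx (tensmap (dec S) (@idfun 'M_bt) Z))).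
  by move=> c X Y; rewrite !linearP.
move: Z; apply: (tens_ext lM (linear_conj2 _ _ lM)) => A B.
rewrite tensmapE ptrace2_swapmx_tens !conj_tens1 -tensmxDl.
by rewrite {1}dec_block linearD /= !ptrace2_conj.
Qed.

Lemma tr_Pbot (R : realType) a : \tr (Pbot R a) = 1.
Proof. by rewrite mxtrace_block mxtrace0 add0r mxtrace1. Qed.

Lemma Pbot_rank1 (R : realType) a (A : 'M[R[i]]_(a + 1)) :
  Pbot R a *m A *m Pbot R a = \tr (Pbot R a *m A *m Pbot R a) *: Pbot R a.
Proof.
rewrite -[A]submxK !mulmx_block !mul0mx !mulmx0 !addr0 !add0r mul1mx mulmx1.
rewrite mxtrace_block mxtrace0 add0r trace_mx11 scale_block_mx !scaler0.
move: (drsubmx A) => D; congr block_mx.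
by apply/matrixP => i j; rewrite !ord1 !mxE eqxx mulr1.
Qed.

(** The reject symbol spans a single dimension, so the reject block is a product. *)
Lemma Pbot_conj (R : realType) a n (X : 'M[R[i]]_((a + 1) * n)) :
  (Pbot R a *t 1%:M) *m X *m (Pbot R a *t 1%:M)
  = Pbot R a *t ptrace1 ((Pbot R a *t 1%:M) *m X *m (Pbot R a *t 1%:M)).
Proof.
move: X; apply: tens_ext => [c X Y|c X Y|A B].
- by rewrite mulmxDr mulmxDl -scalemxAr -scalemxAl.
- by rewrite mulmxDr mulmxDl -scalemxAr -scalemxAl linearP tensmxDr tensmxZr.
- by rewrite conj_tens1 ptrace1_tens tensmxZr {1}Pbot_rank1 tensmxZl.
Qed.

(** The compression of [X] to the reject symbol. On states it is the unnormalized side information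
    upon rejection; by [trpair_bot_tens] it also restricts a test to the reject branch, staying
    within [contr] because it is unital. *)
Definition botmx (R : realType) a n (X : 'M[R[i]]_((a + 1) * n)) : 'M[R[i]]_n :=
  ptrace1 ((Pbot R a *t 1%:M) *m X *m (Pbot R a *t 1%:M)).

Lemma kraus_botmx (R : realType) a n : kraus (@botmx R a n).
Proof.
have := kraus_comp (kraus_ptrace1 R (a + 1) n)
  (kraus_conj (Pbot R a *t (1%:M : 'M_n))).
by rewrite adjmx_tens Pbot_adj adjmx1.
Qed.

Lemma contr_botmx (R : realType) a n (N : 'M[R[i]]_((a + 1) * n)) :
  contr N -> contr (botmx N).
Proof.
apply: contr_unital; first exact: kraus_botmx.
by rewrite /botmx mulmx1 tensmx_mul mulmx1 Pbot_idem ptrace1_tens tr_Pbot scale1r.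
Qed.

Lemma trpair_botmx (R : realType) a n (N : 'M[R[i]]_n) (X : 'M[R[i]]_((a + 1) * n)) :
  trpair N (botmx X) = trpair (Pbot R a *t N) X.
Proof.
by rewrite /botmx trpair_ptrace1 trpair_conj !tensmx_mul mulmx1 mul1mx mulmx1 Pbot_idem.
Qed.

Lemma trpairC (R : realType) n (N X : 'M[R[i]]_n) : trpair N X = trpair X N.
Proof. by rewrite /trpair mxtrace_mulC. Qed.

Lemma trpair_bot_tens (R : realType) a n (N : 'M[R[i]]_((a + 1) * n)) (Y : 'M[R[i]]_n) :
  trpair N (Pbot R a *t Y) = trpair (botmx N) Y.
Proof. by rewrite trpairC -trpair_botmx trpairC. Qed.

Definition rejmap (R : realType) (S : qes R) b bt
    (L : {linear 'M[R[i]]_(dimC S * b)%N -> 'M[R[i]]_(dimC S * bt)%N})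
    (rho : 'M[R[i]]_(dimA S * b)) : 'M[R[i]]_bt := botmx (ptrace2 (attacked L rho)).

Lemma kraus_rejmap (R : realType) (S : qes R) b bt
    (L : {linear 'M[R[i]]_(dimC S * b)%N -> 'M[R[i]]_(dimC S * bt)%N}) :
  channel L -> kraus (rejmap L).
Proof.
move=> cL; exact: (kraus_comp (kraus_botmx R _ _)
  (kraus_comp (kraus_ptrace2 R _ _) (kraus_attacked cL))).
Qed.

(** Rejected equals total minus accepted, and the total involves [rho] only through the key-averaged
    ciphertext. *)
Lemma trpair_rejmap (R : realType) (S : qes R) b bt
    (L : {linear 'M[R[i]]_(dimC S * b)%N -> 'M[R[i]]_(dimC S * bt)%N}) rho N :
  trpair N (rejmap L rho) = trpair (1%:M *t N) (L (ptrace2 (encrypted rho)))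
    - trpair (Pacc R (dimA S) *t N *t 1%:M) (attacked L rho).
Proof.
rewrite trpair_botmx trpair_ptrace2 [X in _ = X - _]/trpair -trM_attacked -/(trpair _ _).
by rewrite -trpairNl -trpairDl PaccE -scaleN1r -!tensmxZl -!tensmxDl scaleN1r opprB addrC subrK.
Qed.

Lemma reject_arith (R : realFieldType) (z z' x x' y y' f s e : R) :
    z = x - y -> z' = x' - y' -> `|y - f| <= e -> `|y' - f| <= e ->
  x - x' <= s -> z - z' <= s + 2%:R * e.
Proof. by move=> -> ->; rewrite !ler_norml => /andP[? _] /andP[_ ?] ?; lra. Qed.

(** The totals differ by at most the secrecy bound, and each of the two accepted parts is within
    [eps] of the same simulated value. *)
Lemma reject_insensitive (R : realType) (S : qes R) (eps : R) b bt
    (L : {linear 'M[R[i]]_(dimC S * b)%N -> 'M[R[i]]_(dimC S * bt)%N})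
    (F : {linear 'M[R[i]]_b -> 'M[R[i]]_bt}) rho rho' (N : 'M[R[i]]_bt) :
  GYZ_authenticating eps S -> 0 < eps <= 1 ->
  channel L -> cp_map F -> accept_simulated eps L F ->
  state rho -> state rho' -> ptrace1 rho = ptrace1 rho' -> contr N ->
  trpair N (rejmap L rho) - trpair N (rejmap L rho')
    <= 9%:R / 2%:R * Num.sqrt eps + 2%:R * eps.
Proof.
move=> GYZ e01 cL cF GF srho srho' eqB cN.
have h1 := accept_marginal cL cF srho GF cN.
have h2 := accept_marginal cL cF srho' GF cN; rewrite -eqB in h2.
(* The attack is moved onto the test by duality, so that [secrecy] applies to the states before the
   attack. *)
have [g [kg g1 gE]] := kraus_dual (kraus_cp_map cL.1) cL.2.
have /(contr_unital kg g1) cg := contr_tensl (dimC S) cN.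
have psdEb (r : 'M_(dimA S * b)) : state r -> psd (ptrace2 (encrypted r)).
  by move=> [+ _] => /(kraus_psd (kraus_encrypted S b)); exact: (kraus_psd (kraus_ptrace2 _ _ _)).
have h3 : trpair (1%:M *t N) (L (ptrace2 (encrypted rho)))
    - trpair (1%:M *t N) (L (ptrace2 (encrypted rho')))
    <= 9%:R / 2%:R * Num.sqrt eps.
  apply: le_trans (secrecy GYZ e01 srho srho' eqB).
  have gp X : trpair (1%:M *t N) (L X) = trpair (g (1%:M *t N)) X.
    by rewrite /trpair gE.
  rewrite gp [X in _ - X]gp -trpairNr -trpairDr.
  apply: trpair_le_trnorm cg.
  by rewrite adjmxD adjmxN !(psd_herm (psdEb _ _)).
exact: (reject_arith (trpair_rejmap L rho N) (trpair_rejmap L rho' N) h1 h2 h3).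
Qed.

(** The test N = 1 puts [f] within [eps] of the true acceptance probability, to which the reject
    probability [r] is complementary. *)
Lemma simulator_total (R : realType) (S : qes R) (eps : R) b bt
    (L : {linear 'M[R[i]]_(dimC S * b)%N -> 'M[R[i]]_(dimC S * bt)%N})
    (F : {linear 'M[R[i]]_b -> 'M[R[i]]_bt}) rho :
  channel L -> cp_map F -> accept_simulated eps L F -> state rho ->
  let f := complex.Re (\tr (F (ptrace1 rho))) in
  let r := complex.Re (\tr (rejmap L rho)) in
  [/\ f <= 1 + eps, r <= 1 & 1 - eps <= f + r <= 1 + eps].
Proof.
move=> cL cF GF srho f r.
have c1 : contr (1%:M : 'M[R[i]]_bt).
  by apply: contr_psd; rewrite ?subrr; [exact: psd1 | exact: psd0].
have := accept_marginal cL cF srho GF c1; rewrite trpair1 -/f.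
have : r = 1 - trpair (Pacc R (dimA S) *t 1%:M *t 1%:M) (attacked L rho).
  rewrite /r -trpair1 trpair_rejmap tensmx11 trpair1 cL.2.
  by rewrite tr_ptrace2 tr_encrypted srho.2.
have pG : psd (attacked L rho) := kraus_psd (kraus_attacked cL) srho.1.
have p0 : 0 <= trpair (Pacc R (dimA S) *t (1%:M : 'M_bt) *t (1%:M : 'M_(dimK S))) (attacked L rho).
  apply: trpair_psd_ge0 pG; apply: (kraus_psd (kraus_tensr _ (@psd1 R _))).
  exact: (kraus_psd (kraus_tensr _ (@psd1 R _)) (@psd_Pacc R _)).
have r0 : 0 <= r by apply/Re_ge0/psd_trace_ge0/(kraus_psd (kraus_rejmap cL) srho.1).
move: p0 r0; move: (trpair _ (attacked L rho)) (r) (f) => p r' f' p0 r0 rE.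
rewrite ler_norml => /andP[h1 h2]; split; [lra|lra|].
by apply/andP; split; lra.
Qed.

Lemma kraus_linear_cp (R : realType) m n (f : 'M[R[i]]_m -> 'M[R[i]]_n) :
  kraus f -> exists2 g : {linear 'M[R[i]]_m -> 'M[R[i]]_n}, cp_map g & g =1 f.
Proof.
by case=> s fs; exists (kraus_map s); [exact: kraus_map_cp | move=> X; rewrite fs].
Qed.

Lemma acceptedZ (R : realType) a b bt (c : R[i])
    (F G : {linear 'M[R[i]]_b -> 'M[R[i]]_bt}) (rho : 'M[R[i]]_(a * b)) :
  G =1 (fun X => c *: F X) -> accepted G rho = c *: accepted F rho.
Proof.
move=> GF; rewrite /accepted -linearZ /=; congr tensmap.
move: rho; apply: tens_ext => [x X Y|x X Y|A B].
- by rewrite linearP.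
- by rewrite linearP scalerDr !scalerA mulrC.
- by rewrite !tensmapE GF tensmxZr.
Qed.

Lemma psd_trace_real (R : realType) n (X : 'M[R[i]]_n) :
  psd X -> \tr X = (complex.Re (\tr X))%:C.
Proof. by move=> /psd_trace_ge0 /ger0_real /RRe_real. Qed.

Definition msg0 (R : realType) (S : qes R) : 'M[R[i]]_(dimA S) :=
  delta_mx (Ordinal (dimA_gt0 S)) (Ordinal (dimA_gt0 S)).

Lemma ptrace1_msg0 (R : realType) (S : qes R) b (X : 'M[R[i]]_b) :
  ptrace1 (msg0 S *t X) = X.
Proof. by rewrite ptrace1_tens tr_delta scale1r. Qed.

Lemma state_msg0 (R : realType) (S : qes R) b (X : 'M[R[i]]_b) :
  state X -> state (msg0 S *t X).
Proof.
move=> [pX tX]; split; last by rewrite trace_tens tr_delta mul1r.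
exact: (kraus_psd (kraus_tensl b (@psd_delta R _ _)) pX).
Qed.

(* The trace missing from the simulator rescaled by [(1 + eps)^-1]; it is
   restored in the reject branch. *)
Definition deficit (R : realType) (S : qes R) (eps : R) b bt
    (L : {linear 'M[R[i]]_(dimC S * b)%N -> 'M[R[i]]_(dimC S * bt)%N})
    (F : {linear 'M[R[i]]_b -> 'M[R[i]]_bt}) (X : 'M[R[i]]_b) : R[i]^o :=
  \tr X - ((1 + eps)^-1)%:C * (\tr (F X) + \tr (rejmap L (msg0 S *t X))).

Lemma kraus_rejmap_msg0 (R : realType) (S : qes R) b bt
    (L : {linear 'M[R[i]]_(dimC S * b)%N -> 'M[R[i]]_(dimC S * bt)%N}) :
  channel L -> kraus (fun X => rejmap L (msg0 S *t X)).
Proof.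
move=> cL; exact: (kraus_comp (kraus_rejmap cL) (kraus_tensl b (@psd_delta R _ _))).
Qed.

Lemma deficit_linear (R : realType) (S : qes R) (eps : R) b bt
    (L : {linear 'M[R[i]]_(dimC S * b)%N -> 'M[R[i]]_(dimC S * bt)%N})
    (F : {linear 'M[R[i]]_b -> 'M[R[i]]_bt}) :
  channel L -> linear (deficit eps L F).
Proof.
move=> cL c X Y; rewrite /deficit (kraus_linear (kraus_rejmap_msg0 cL)) (linearP F).
have distr (k t t' f f' g g' : R[i]) : (c * t + t') - k * ((c * f + f') + (c * g + g'))
    = c * (t - k * (f + g)) + (t' - k * (f' + g')) by ring.
rewrite !mxtraceD !mxtraceZ; exact: distr.
Qed.

(** By [simulator_total] the total weight lies in [1 - eps, 1 + eps]; divided by 1 + eps it falls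
    short of 1 by at most 2 eps / (1 + eps). *)
Lemma deficit_state (R : realType) (S : qes R) (eps : R) b bt
    (L : {linear 'M[R[i]]_(dimC S * b)%N -> 'M[R[i]]_(dimC S * bt)%N})
    (F : {linear 'M[R[i]]_b -> 'M[R[i]]_bt}) X :
  0 < eps -> channel L -> cp_map F -> accept_simulated eps L F -> state X ->
  exists2 r : R, deficit eps L F X = r%:C & 0 <= r <= 2%:R * eps.
Proof.
move=> e0 cL cF GF sX.
pose f := complex.Re (\tr (F X)); pose r := complex.Re (\tr (rejmap L (msg0 S *t X))).
have [_ _ /andP[h1 h2]] : [/\ f <= 1 + eps, r <= 1 & 1 - eps <= f + r <= 1 + eps].
  by have := simulator_total cL cF GF (state_msg0 S sX); rewrite ptrace1_msg0; exact.
have fE : \tr (F X) = f%:C := psd_trace_real (kraus_psd (kraus_cp_map cF) sX.1).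
have rE : \tr (rejmap L (msg0 S *t X)) = r%:C :=
  psd_trace_real (kraus_psd (kraus_rejmap cL) (state_msg0 S sX).1).
exists (1 - (1 + eps)^-1 * (f + r)).
  by rewrite /deficit sX.2 fE rE rmorphB rmorphM rmorphD.
move: h1 h2; move: (f) (r) => {fE rE}f {}r h1 h2.
have k1 : (1 + eps)^-1 * (1 + eps) = 1 by rewrite mulVf //; lra.
have k0 : 0 < (1 + eps)^-1 by rewrite invr_gt0; lra.
move: k1 k0; move: (_^-1) => k k1 k0.
have h3 := ler_wpM2l (ltW k0) h1; have h4 := ler_wpM2l (ltW k0) h2.
have h5 : k * eps <= eps by rewrite ler_piMl //; [lra|nra].
by apply/andP; split; lra.
Qed.

Lemma deficit_ge0 (R : realType) (S : qes R) (eps : R) b bt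
    (L : {linear 'M[R[i]]_(dimC S * b)%N -> 'M[R[i]]_(dimC S * bt)%N})
    (F : {linear 'M[R[i]]_b -> 'M[R[i]]_bt}) X :
  0 < eps -> channel L -> cp_map F -> accept_simulated eps L F -> psd X ->
  0 <= (deficit eps L F X : R[i]).
Proof.
move=> e0 cL cF GF pX; have lD := deficit_linear eps F cL.
have tE := psd_trace_real pX; move: tE; set t := complex.Re _ => tE.
have t0 : 0 <= t by apply/Re_ge0/psd_trace_ge0.
(* Trace zero forces X = 0; any other positive [X] is a positive multiple of a state. *)
have [t00|tn0] := eqVneq t 0.
  have -> : X = 0 by apply: psd_trace0; rewrite // tE t00.
  have := lD (-1) 0 0; rewrite scaler0 addr0 scaleN1r addNr => -> //.
have tp : 0 < t by rewrite lt_def tn0.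
have sX : state ((t^-1)%:C *: X).
  split; first by apply: psdZ => //; rewrite ler0c invr_ge0.
  by rewrite mxtraceZ tE -rmorphM /= mulVf.
have [r rE /andP[r0 _]] := deficit_state e0 cL cF GF sX.
have -> : X = t%:C *: ((t^-1)%:C *: X) + 0.
  by rewrite addr0 scalerA -rmorphM /= mulfV // scale1r.
have D0 : deficit eps L F 0 = 0.
  by have := lD (-1) 0 0; rewrite scaler0 addr0 scaleN1r addNr.
by rewrite lD D0 addr0 rE mulr_ge0 ?ler0c.
Qed.

(** With 1 - k = k e, the errors are: e on the accepted part; e from rescaling it, as (1 - k)(1 + e)
    = e; 9/2 s + 2 e for the change of input on rejection; e from rescaling that; and 2 e for the
    deficit. Their sum 9/2 s + 7 e is below 12 s. *)
Lemma simulator_arith (R : realFieldType) (e s k p a f1 z z0 r0 d sg : R) :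
    0 < e -> e <= s -> k * (1 + e) = 1 -> p <= e -> a <= f1 -> f1 <= 1 + e ->
    z - z0 <= 9%:R / 2%:R * s + 2%:R * e -> z0 <= r0 -> r0 <= 1 ->
    0 <= d <= 2%:R * e -> - sg <= 1 ->
  p + (a - k * a) + (z - k * z0 - d * sg) <= 12%:R * s.
Proof.
move=> e0 es kE pe af f1e zz zr r1 /andP[d0 de] sg1.
have k0 : 0 < k.
  by have := @ltr01 R; rewrite -kE pmulr_lgt0 //; lra.
have ke : 1 - k = k * e by lra.
have ke0 : 0 <= k * e by rewrite mulr_ge0 ?ltW.
have h1 : a - k * a <= e.
  have : (1 - k) * a <= (1 - k) * (1 + e) by apply: ler_wpM2l; lra.
  lra.
have h2 : (1 - k) * z0 <= (1 - k) * 1 by apply: ler_wpM2l; lra.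
have h3 : k * e <= 1 * e by apply: ler_wpM2r; [exact: ltW | lra].
have h4 : d * (- sg) <= d * 1 by apply: ler_wpM2l.
lra.
Qed.

(** * Degenerate dimensions and the final estimate *)

Lemma mxtrace_muln0 (T : pzSemiRingType) c (X : 'M[T]_(c * 0)) : \tr X = 0.
Proof.
by apply: big1 => i; have := ltn_ord i; rewrite [X in (_ < X)%N]muln0.
Qed.

(** Trace preservation excludes a channel from a nonzero space to the zero space. So a
    zero-dimensional output, which holds no state to carry the missing trace, occurs only with a
    zero-dimensional B. *)
Lemma channel_codim0 (R : realType) c b
    (L : {linear 'M[R[i]]_(c * b)%N -> 'M[R[i]]_(c * 0)%N}) :
  (0 < c)%N -> channel L -> b = 0%N.
Proof.
case: b L => [//|b] L; case: c L => [//|c] L _ [_ /(_ (delta_mx ord0 ord0))].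
rewrite (tr_delta R ord0) mxtrace_muln0 => /eqP.
by rewrite eq_sym oner_eq0.
Qed.

(** A zero-dimensional space carries no states, so zero maps simulate the attack. *)
Lemma DNS_dim0 (R : realType) (eps : R) (S : qes R) bt
    (L : {linear 'M[R[i]]_(dimC S * 0)%N -> 'M[R[i]]_(dimC S * bt)%N}) :
  exists Lacc Lrej : {linear 'M[R[i]]_0 -> 'M[R[i]]_bt},
    [/\ cp_map Lacc, cp_map Lrej,
        forall X, \tr (Lacc X + Lrej X) = \tr X &
        forall rho : 'M[R[i]]_(dimA S * 0)%N, state rho ->
          trnorm (ptrace2 (attacked L rho) - (accepted Lacc rho
                     + Pbot R (dimA S) *t Lrej (ptrace1 rho))) <= eps].
Proof.
exists (kraus_map [::]), (kraus_map [::]).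
have c0 : cp_map (kraus_map [::] : 'M[R[i]]_0 -> 'M[R[i]]_bt) by exact: kraus_map_cp.
split => // [X|rho [_ tr1]].
  by rewrite [X]flatmx0 !linear0 addr0 mxtrace0.
by have /eqP := oner_neq0 R[i]; rewrite -tr1 mxtrace_muln0.
Qed.

(** The gap is split as in [simulator_arith]: simulation error on acceptance, rescaling of the
    accepted part, and the reject branch. *)
Lemma trpair_simulator_gap (R : realType) a n (N M MP A : 'M[R[i]]_((a + 1) * n))
    (r r0 sg : 'M[R[i]]_n) (k d : R) : M = MP + Pbot R a *t r ->
  trpair N (M - (k%:C *: A + Pbot R a *t (k%:C *: r0 + d%:C *: sg)))
  = trpair N (MP - A) + (trpair N A - k * trpair N A)
    + (trpair (botmx N) r - k * trpair (botmx N) r0 - d * trpair (botmx N) sg).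
Proof.
move=> ->; rewrite !(trpairDr, trpairNr, trpairZr, trpair_bot_tens); ring.
Qed.

Theorem theorem5p34 (R : realType) :
  exists eps0 c : R,
    [/\ 0 < eps0, 0 < c &
      forall eps : R, 0 < eps <= eps0 ->
      forall S : qes R,
        GYZ_authenticating eps S ->
        DNS_authenticating (c * Num.sqrt eps) S].
Proof.
(* The bound eps <= 1 gives eps <= sqrt eps and a weak measurement strength h <= 1; the constant 12
   is that of [simulator_arith]. *)
exists 1, 12%:R; split; [exact: ltr01 | by rewrite ltr0n |].
move=> eps e01 S GYZ b [|bt] L cL.
  have b0 := channel_codim0 (dimC_gt0 S) cL; subst b.
  exact: DNS_dim0.
have [e0 e1] := andP e01.
have [F [cF GF]] := GYZ _ _ L cL.
set k : R := (1 + eps)^-1.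
have k1 : k * (1 + eps) = 1 by rewrite mulVf //; lra.
have k0 : (0 : R[i]) <= k%:C by rewrite ler0c invr_ge0; lra.
(* [sg] is a fixed state of the nonzero output space that carries the missing trace. *)
pose sg : 'M[R[i]]_bt.+1 := delta_mx ord0 ord0.
have psg : psd sg by exact: psd_delta.
have [Lacc cLacc LaccE] := kraus_linear_cp (kraus_scale k0 (kraus_cp_map cF)).
(* The reject simulator runs the attack on a fixed message next to B, rescaled by [k], and adds the
   deficit of both branches times [sg]. *)
have [Lrej cLrej LrejE] := kraus_linear_cp (kraus_add
  (kraus_scale k0 (kraus_rejmap_msg0 cL))
  (kraus_functional (deficit_linear eps F cL)
    (fun X => deficit_ge0 e0 cL cF GF (X := X)) psg)).
exists Lacc, Lrej; split => // [X|rho srho].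
  rewrite mxtraceD LaccE LrejE mxtraceD !mxtraceZ (tr_delta R ord0) mulr1 /deficit -/k.
  have sumE (c t f g : R[i]) : c * f + (c * g + (t - c * (f + g))) = t by ring.
  exact: sumE.
have srB : state (ptrace1 rho).
  by split; [exact: (kraus_psd (kraus_ptrace1 R _ _) srho.1) | rewrite tr_ptrace1 srho.2].
(* [rho0] is the input on which the simulator runs the attack; it shares the marginal on B with
   [rho], as [reject_insensitive] requires. *)
pose rho0 := msg0 S *t ptrace1 rho.
have srho0 : state rho0 by exact: state_msg0.
have eqB : ptrace1 rho = ptrace1 rho0 by rewrite ptrace1_msg0.
have pA : psd (accepted F rho) := kraus_psd (@kraus_accepted R (dimA S) _ _ F cF) srho.1.
have pR0 : psd (rejmap L rho0) := kraus_psd (kraus_rejmap cL) srho0.1.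
have [d dE d01] := deficit_state e0 cL cF GF srB.
set M := ptrace2 (attacked L rho).
have pM : psd M := kraus_psd (kraus_ptrace2 R _ _) (kraus_psd (kraus_attacked cL) srho.1).
have accE : accepted Lacc rho = k%:C *: accepted F rho by exact: acceptedZ.
have rejE : Lrej (ptrace1 rho) = k%:C *: rejmap L rho0 + d%:C *: sg by rewrite LrejE dE.
rewrite accE rejE; set Y := _ *: _ + _ *: _ : 'M[R[i]]_bt.+1.
have pY : psd (Pbot R (dimA S) *t Y).
  rewrite /Y -rejE; apply: (kraus_psd (kraus_tensl _ (@psd_Pbot R (dimA S)))).
  exact: (kraus_psd (kraus_cp_map cLrej) srB.1).
(* A single optimal test [N] turns the trace norm into a real pairing, to which the accept and
   reject bounds apply separately. *)
have /trnorm_attained [N [hN NN ->]] : (M - (k%:C *: accepted F rho + Pbot R (dimA S) *t Y))^t*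
    = M - (k%:C *: accepted F rho + Pbot R (dimA S) *t Y).
  have pkA := psdZ k0 pA.
  by rewrite adjmxD adjmxN (psd_herm pM) (psd_herm (psdD pkA pY)).
have cN := contr_reflection hN NN; have cNb := contr_botmx cN.
have ME : M = (Pacc R (dimA S) *t 1%:M) *m M *m (Pacc R (dimA S) *t 1%:M)
    + Pbot R (dimA S) *t rejmap L rho.
  by rewrite /rejmap /botmx -Pbot_conj /M attackedE -marginal_block.
rewrite /Y (trpair_simulator_gap N (accepted F rho) (rejmap L rho0) sg k d ME).
have [fle rle _] := simulator_total cL cF GF srho0.
have es : eps <= Num.sqrt eps.
  rewrite -{1}(sqr_sqrtr (ltW e0)) expr2 ler_piMr ?sqrtr_ge0 //.
  by rewrite -sqrtr1 ler_wsqrtr.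
(* The trace of the accepted part is that of [F] on the marginal on B, so the bound found for [rho0]
   carries over. *)
have trA : complex.Re (\tr (accepted F rho)) <= 1 + eps.
  have := trM_accepted F 1%:M rho; rewrite tensmx11 !mul1mx eqB => ->.
  exact: fle.
have sg1 : - trpair (botmx N) sg <= 1.
  rewrite -trpairNl; apply: le_trans (trpair_contr_psd (contrN cNb) psg) _.
  by rewrite (tr_delta R ord0).
exact: (simulator_arith e0 es k1 (accept_pair_le cL cF srho GF cN)
  (trpair_contr_psd cN pA) trA
  (reject_insensitive GYZ e01 cL cF GF srho srho0 eqB cNb)
  (trpair_contr_psd cNb pR0) rle d01 sg1).
Qed.
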